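(* Let $n\ge 3$, and let $f\in\mathcal F(\mathbb K^n)$ be a quasihomogeneous polynomial with $f(0)=0$ and of finite codimension. Let $p\in\mathbb Z$. 1. If $p>0$ then $H^0_{f,p}(\mathbb K^n)=\{0\}$. 2. If $p\le 0$ then $H^0_{f,p}(\mathbb K^n)=\mathbb K\cdot f^{-p}$.
   Context: $\mathbb K=\mathbb R$ or $\mathbb C$. One works in a fixed category: holomorphic ($\mathbb K=\mathbb C$), real analytic or $C^\infty$ ($\mathbb K=\mathbb R$), or formal. $\mathcal F(\mathbb K^n)$ and $\Omega^k(\mathbb K^n)$ denote the spaces of germs at $0$ of functions and $k$-forms in that category (formal power series, and forms with such coefficients, in the formal case). $f$ is of finite codimension if $Q_f=\mathcal F(\mathbb K^n)/I_f$ is finite dimensional, $I_f$ being the ideal generated by the partial derivatives of $f$. $f$ is quasihomogeneous of degree $\mathrm N$ if there are positive integers $w_1,\dots,w_n$ such that $W.f=\mathrm N f$ with $W=\sum_iw_ix_i\frac{\partial}{\partial x_i}$. For $p\in\mathbb Z$, $d_f^{(p)}:\Omega^k(\mathbb K^n)\to\Omega^{k+1}(\mathbb K^n)$, $d_f^{(p)}\alpha=f\,d\alpha-(k-p)\,df\wedge\alpha$, and $H^k_{f,p}(\mathbb K^n)$ is the $k$-th cohomology space of the complex $(\Omega^\bullet(\mathbb K^n),d_f^{(p)})$; in particular $H^0_{f,p}(\mathbb K^n)=\{g\in\mathcal F(\mathbb K^n): f\,dg+p\,g\,df=0\}$. *)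

(* Defs.v *)
From HB Require Import structures.
From mathcomp Require Import all_boot all_order all_algebra.
From mathcomp Require Import generic_quotient ring_quotient finmap.
From mathcomp Require Import all_classical all_reals all_analysis.
From mathcomp.analysis.showcase Require Import summability.
From mathcomp.real_closed Require Import complex.
(* The notations of mpoly clash with those of the analysis library. *)
From mathcomp Require Import -(notations) mpoly.

Set Implicit Arguments.
Unset Strict Implicit.
Unset Printing Implicit Defensive.
Set SsrOldRewriteGoalsOrder.

Import Order.TTheory GRing.Theory Num.Theory numFieldNormedType.Exports.
Local Open Scope classical_set_scope.
Local Open Scope quotient_scope.
Local Open Scope ring_scope.

(* A space of germs at 0 of functions on K^n is given as a subset of a possibly
   larger algebra, in which the partial derivatives are total operations. *)
Record germ_space (K : numFieldType) (n : nat) := GermSpace {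
  ambient : comAlgType K ;
  germs : set ambient ;
  partial : 'I_n -> ambient -> ambient ;
  germ_of_polynomial : mpoly n K -> ambient }.

Arguments germs {K n} _ _.
Arguments partial {K n} _ _ _.
Arguments germ_of_polynomial {K n} _ _.

Section FormalPowerSeries.
Variables (K : numFieldType) (n : nat).

(* A formal power series is the family of its coefficients. *)
Definition fps : Type := multinom n -> K.

HB.instance Definition _ := GRing.Lmodule.copy fps (multinom n -> K).

Implicit Types (f g h : fps) (m : multinom n).

(* The coefficient of X^m in f * g is the sum of all f_a g_b with a + b = m. *)
Definition fps_mul f g : fps := fun m =>
  \sum_(k : bmultinom n (mdeg m).+1 * bmultinom n (mdeg m).+1
         | m == mnm_add k.1 k.2) f k.1 * g k.2.

Definition fps_of_mpoly (P : mpoly n K) : fps := fun m => mcoeff m P.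

Let trunc d f : mpoly n K :=
  \sum_(m : bmultinom n d) f m *: mpolyX K m.

Let mcoeff_trunc d f m : (mdeg m < d)%N -> mcoeff m (trunc d f) = f m.
Proof.
move=> md; rewrite raddf_sum (bigD1 (BMultinom md)) //= big1 ?addr0.
  by rewrite mcoeffZ mcoeffX eqxx mulr1.
move=> i ne; rewrite mcoeffZ mcoeffX; case: eqP => [e|]; rewrite ?mulr0 //.
by case/eqP: ne; apply: val_inj.
Qed.

Let fps_mulE d f g m : (mdeg m < d)%N ->
  fps_mul f g m = mcoeff m (trunc d f * trunc d g).
Proof.
move=> md; rewrite mcoeffM; apply: eq_bigr => -[a b] /= /eqP e.
have ed : (mdeg a + mdeg b = mdeg m)%N by rewrite [in RHS]e mdegD.
have la : (mdeg a < d)%N.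
  by apply: leq_ltn_trans md; apply: leq_trans (eq_leq ed); apply: leq_addr.
have lb : (mdeg b < d)%N.
  by apply: leq_ltn_trans md; apply: leq_trans (eq_leq ed); apply: leq_addl.
by rewrite !mcoeff_trunc.
Qed.

Let fps_mul_mcoeff d (p q : mpoly n K) f g m : (mdeg m < d)%N ->
  (forall k, (mdeg k < d)%N -> mcoeff k p = f k) ->
  (forall k, (mdeg k < d)%N -> mcoeff k q = g k) ->
  mcoeff m (p * q) = fps_mul f g m.
Proof.
move=> md ep eq; rewrite mcoeffM; apply: eq_bigr => -[a b] /= /eqP e.
have ed : (mdeg a + mdeg b = mdeg m)%N by rewrite [in RHS]e mdegD.
have la : (mdeg a < d)%N.
  by apply: leq_ltn_trans md; apply: leq_trans (eq_leq ed); apply: leq_addr.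
have lb : (mdeg b < d)%N.
  by apply: leq_ltn_trans md; apply: leq_trans (eq_leq ed); apply: leq_addl.
by rewrite ep ?eq.
Qed.

Let fps_mulA : associative fps_mul.
Proof.
move=> f g h; apply/funext => m.
pose d := (mdeg m).+1; pose T := trunc d.
rewrite -(@fps_mul_mcoeff d (T f) (T g * T h)) //; last 2 first.
- by move=> k; exact: mcoeff_trunc.
- by move=> k kd; rewrite -fps_mulE.
rewrite -(@fps_mul_mcoeff d (T f * T g) (T h)) ?mulrA //.
- by move=> k kd; rewrite -fps_mulE.
- by move=> k; exact: mcoeff_trunc.
Qed.

Let fps_mulC : commutative fps_mul.
Proof.
by move=> f g; apply/funext => m; rewrite !(fps_mulE _ _ (ltnSn _)) mulrC.
Qed.

Let fps_mul1 : left_id (fps_of_mpoly 1) fps_mul.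
Proof.
move=> f; apply/funext => m.
rewrite -(@fps_mul_mcoeff (mdeg m).+1 1 (trunc (mdeg m).+1 f)) //.
  by rewrite mul1r mcoeff_trunc.
by move=> k; exact: mcoeff_trunc.
Qed.

Let fps_mulDl : left_distributive fps_mul +%R.
Proof.
move=> f g h; apply/funext => m.
rewrite -[RHS]/(fps_mul f h m + fps_mul g h m) /fps_mul -big_split.
by apply: eq_bigr => k _; exact: mulrDl.
Qed.

Let fps_1neq0 : fps_of_mpoly 1 != 0 :> fps.
Proof.
apply/eqP => /(congr1 (fun f : fps => f mnm0)).
by rewrite /fps_of_mpoly mcoeff1 eqxx => /eqP; rewrite oner_eq0.
Qed.

HB.instance Definition _ := GRing.Zmodule_isComNzRing.Build fps
  fps_mulA fps_mulC fps_mul1 fps_mulDl fps_1neq0.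

Let fps_scaleAl (c : K) f g : c *: (f * g) = c *: f * g.
Proof.
apply/funext => m.
rewrite -[LHS]/(c * fps_mul f g m) -[RHS]/(fps_mul (c *: f) g m).
by rewrite /fps_mul mulr_sumr; apply: eq_bigr => k _; rewrite mulrA.
Qed.

HB.instance Definition _ := GRing.Lmodule_isLalgebra.Build K fps fps_scaleAl.
HB.instance Definition _ := GRing.Lalgebra_isComAlgebra.Build K fps.

Definition fps_partial (i : 'I_n) f : fps :=
  fun m => (m i).+1%:R * f (mnm_add m (mnm1 i)).

Definition formal_germs : germ_space K n :=
  @GermSpace K n fps setT fps_partial fps_of_mpoly.

End FormalPowerSeries.

Section FunctionGerms.
Variables (K : numFieldType) (n : nat).
Local Notation V := 'rV[K]_n.

Definition vanishing_near0 : pred (V -> K) :=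
  fun h => `[< \forall x \near (0 : V), h x = 0 >].

Let vanishing_near0_ideal : idealr_closed vanishing_near0.
Proof.
split.
- by apply/asboolP; near=> x.
- apply/negP => /asboolP /nbhs_singleton /eqP.
  by rewrite oner_eq0.
- move=> a u v /asboolP u0 /asboolP v0; apply/asboolP; near=> x.
  rewrite -[LHS]/(a x * u x + v x).
  have -> : u x = 0 by near: x.
  have -> : v x = 0 by near: x.
  by rewrite mulr0 addr0.
Unshelve. all: by end_near.
Qed.

HB.instance Definition _ :=
  isIdealr.Build (V -> K) vanishing_near0 vanishing_near0_ideal.

Definition vanishing_ideal : idealr (V -> K) := vanishing_near0.

Definition fun_germ : Type := {ideal_quot vanishing_ideal}.

HB.instance Definition _ := GRing.ComNzRing.on fun_germ.

Definition germ_of (h : V -> K) : fun_germ := \pi_{ideal_quot vanishing_ideal} h.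

Definition germ_repr (g : fun_germ) : V -> K :=
  repr (g : {ideal_quot vanishing_ideal}).

Lemma germ_reprK : cancel germ_repr germ_of.
Proof. exact: reprK. Qed.

Lemma germ_ofP (h1 h2 : V -> K) :
  germ_of h1 = germ_of h2 <-> \forall x \near (0 : V), h1 x = h2 x.
Proof.
split=> [/eqP|h12].
  rewrite -Quotient.idealrBE => /asboolP; apply: filterS => x.
  by move=> /eqP; rewrite subr_eq0 => /eqP.
apply/eqP; rewrite -Quotient.idealrBE; apply/asboolP.
by move: h12; apply: filterS => x e; apply/eqP; rewrite subr_eq0 e.
Qed.

Lemma germ_ofD : {morph germ_of : h1 h2 / h1 + h2}.
Proof. exact: rmorphD. Qed.

Lemma germ_ofN : {morph germ_of : h / - h}.
Proof. exact: rmorphN. Qed.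

Lemma germ_ofM : {morph germ_of : h1 h2 / h1 * h2}.
Proof. exact: rmorphM. Qed.

Lemma germ_of0 : germ_of 0 = 0. Proof. exact: rmorph0. Qed.

Lemma germ_of1 : germ_of 1 = 1. Proof. exact: rmorph1. Qed.

Definition germ_scale (c : K) (g : fun_germ) : fun_germ := germ_of (cst c) * g.

Let germ_scaleA a b g : germ_scale a (germ_scale b g) = germ_scale (a * b) g.
Proof. by rewrite /germ_scale mulrA -germ_ofM. Qed.

Let germ_scale1 : left_id 1 germ_scale.
Proof. by move=> g; rewrite /germ_scale -[cst 1]/(1 : V -> K) germ_of1 mul1r. Qed.

Let germ_scaleDr : right_distributive germ_scale +%R.
Proof. by move=> c g1 g2; rewrite /germ_scale mulrDr. Qed.

Let germ_scaleDl g : {morph germ_scale^~ g : a b / a + b}.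
Proof. by move=> a b; rewrite /germ_scale -mulrDl -germ_ofD. Qed.

HB.instance Definition _ := GRing.Zmodule_isLmodule.Build K fun_germ
  germ_scaleA germ_scale1 germ_scaleDr germ_scaleDl.

Let germ_scaleAl (c : K) (g1 g2 : fun_germ) : c *: (g1 * g2) = c *: g1 * g2.
Proof. exact: mulrA. Qed.

HB.instance Definition _ :=
  GRing.Lmodule_isLalgebra.Build K fun_germ germ_scaleAl.
HB.instance Definition _ := GRing.Lalgebra_isComAlgebra.Build K fun_germ.

Lemma germ_ofZ (c : K) (h : V -> K) : germ_of (c *: h) = c *: germ_of h.
Proof. by rewrite -[RHS]germ_ofM. Qed.

Definition fun_partial (i : 'I_n) (h : V -> K) : V -> K :=
  fun x => 'D_(delta_mx 0 i) h x.

Definition germ_partial (i : 'I_n) (g : fun_germ) : fun_germ :=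
  germ_of (fun_partial i (germ_repr g)).

Lemma fun_partial_near (i : 'I_n) (h1 h2 : V -> K) :
  (\forall x \near (0 : V), h1 x = h2 x) ->
  \forall x \near (0 : V), fun_partial i h1 x = fun_partial i h2 x.
Proof.
by move=> /near_join; apply: filterS => x; exact: near_eq_derive.
Qed.

Lemma germ_partialE (i : 'I_n) (h : V -> K) :
  germ_partial i (germ_of h) = germ_of (fun_partial i h).
Proof.
by apply/germ_ofP/fun_partial_near/germ_ofP; rewrite germ_reprK.
Qed.

Definition germ_of_mpoly (P : mpoly n K) : fun_germ :=
  germ_of (fun x => meval (x 0) P).

(* Unconditional convergence over all multi-indices: the sums over finite sets
   of multi-indices converge along the filter of finite sets. *)
Definition analytic_near0 (h : V -> K) : Prop :=
  exists a : multinom n -> K, \forall x \near (0 : V),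
    partial_sum (fun m : multinom n => a m * \prod_(i < n) (x : V) 0 i ^+ m i)
      @ totally --> h x.

Definition analytic_germs : germ_space K n :=
  @GermSpace K n fun_germ (germ_of @` analytic_near0) germ_partial germ_of_mpoly.

(* One neighbourhood of 0 serves for the partial derivatives of all orders. *)
Definition smooth_near0 (h : V -> K) : Prop :=
  \forall x \near (0 : V), forall s : seq 'I_n,
    {for x, continuous (foldr fun_partial h s)} /\
    forall i : 'I_n, derivable (foldr fun_partial h s) x (delta_mx 0 i).

Definition smooth_germs : germ_space K n :=
  @GermSpace K n fun_germ (germ_of @` smooth_near0) germ_partial germ_of_mpoly.

End FunctionGerms.

Inductive category : Set :=
  Holomorphic | RealAnalytic | Smooth | FormalReal | FormalComplex.

Definition scalars (R : realType) (C : category) : numFieldType :=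
  match C with
  | Holomorphic | FormalComplex => R[i]
  | RealAnalytic | Smooth | FormalReal => R
  end.

(* Germs of holomorphic functions are the germs of sums of convergent power
   series with complex coefficients. *)
Definition germs_in (R : realType) (C : category) (n : nat) :
    germ_space (scalars R C) n :=
  match C with
  | Holomorphic => analytic_germs R[i] n
  | RealAnalytic => analytic_germs R n
  | Smooth => smooth_germs R n
  | FormalReal => formal_germs R n
  | FormalComplex => formal_germs R[i] n
  end.

Lemma partial0 (R : realType) (C : category) (n : nat) (i : 'I_n) :
  partial (germs_in R C n) i 0 = 0.
Proof.
have fps0 (K : numFieldType) : fps_partial i (0 : fps K n) = 0.
  by apply/funext => m; rewrite /fps_partial mulr0.
have germ0 (K : numFieldType) : germ_partial i (0 : fun_germ K n) = 0.
  rewrite -germ_of0 germ_partialE; congr germ_of; apply/funext => x.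
  exact: derive_cst.
by case: C => /=.
Qed.

Lemma germs0 (R : realType) (C : category) (n : nat) :
  germs (germs_in R C n) 0.
Proof.
have analytic0 (K : numFieldType) : germs (analytic_germs K n) 0.
  exists 0; last exact: germ_of0.
  exists 0; apply: (filterE (nbhs_filter _)) => x.
  rewrite (_ : partial_sum _ = cst 0).
    by apply: cvg_cst; exact: (@filter_filter _ _ totally_filter).
  by apply/funext => I; rewrite /partial_sum big1 // => m _; exact: mul0r.
have smooth0 : germs (smooth_germs R n) 0.
  exists 0; last exact: germ_of0.
  apply: (filterE (nbhs_filter _)) => x s.
  have -> : foldr (@fun_partial R n) 0 s = 0.
    by elim: s => //= i s ->; apply/funext => y; exact: derive_cst.
  by split=> [|i]; [exact: cst_continuous|exact: derivable_cst].
case: C => //=; [exact: analytic0|exact: analytic0].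
Qed.

Section Cohomology.
Variables (K : numFieldType) (n : nat) (F : germ_space K n).
Local Notation A := (ambient F).

Definition jacobian_ideal (f : A) : set A :=
  [set g | exists2 h : 'I_n -> A, (forall i, germs F (h i)) &
                                  g = \sum_(i < n) h i * partial F i f].

Definition finite_codimension (f : A) : Prop :=
  exists (d : nat) (e : 'I_d -> A), (forall j, germs F (e j)) /\
    forall g, germs F g -> exists c : 'I_d -> K,
      jacobian_ideal f (g - \sum_(j < d) c j *: e j).

Definition coordinate (i : 'I_n) : A := germ_of_polynomial F (mpolyX K (mnm1 i)).

Definition quasihomogeneous (N : nat) (f : A) : Prop :=
  exists2 w : 'I_n -> nat, (forall i, (0 < w i)%N) &
    \sum_(i < n) (coordinate i * partial F i f) *+ w i = f *+ N.

(* Differential forms of all degrees together: the component at {i1 < ... < ik}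
   is the coefficient of dx_i1 /\ ... /\ dx_ik. *)
Definition diff_form := {set 'I_n} -> A.

Definition Omega (k : nat) : set diff_form :=
  [set alpha : diff_form | (forall I, germs F (alpha I)) /\
               (forall I : {set 'I_n}, #|I| != k -> alpha I = 0)].

Definition form0 (g : A) : diff_form := fun I => if I == finset.set0 then g else 0.

Definition dx (i : 'I_n) : diff_form := fun I => if I == [set i]%SET then 1 else 0.

(* The number of adjacent transpositions sorting I followed by J. *)
Definition inversions (I J : {set 'I_n}) : nat :=
  #|[set ij : 'I_n * 'I_n | [&& ij.1 \in I, ij.2 \in J & (ij.2 < ij.1)%N]]%SET|.

Definition wedge (alpha beta : diff_form) : diff_form := fun J =>
  \sum_(I : {set 'I_n} | I \subset J)
    (-1) ^+ inversions I (J :\: I)%SET * (alpha I * beta (J :\: I)%SET).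

Definition ext_d (alpha : diff_form) : diff_form := fun J =>
  \sum_(i < n) wedge (dx i) (fun I => partial F i (alpha I)) J.

Definition twisted_d (f : A) (p : int) (k : nat) (alpha : diff_form) : diff_form :=
  fun J => f * ext_d alpha J - wedge (ext_d (form0 f)) alpha J *~ (k%:Z - p).

Definition cocycles (f : A) (p : int) (k : nat) : set diff_form :=
  [set alpha : diff_form | Omega k alpha /\ forall J, twisted_d f p k alpha J = 0].

(* There are no forms of degree -1, hence no nonzero coboundaries of degree 0:
   H^0 is the space of cocycles of degree 0. *)
Definition H0 (f : A) (p : int) : set A :=
  [set g | cocycles f p 0 (form0 g)].

Lemma wedge_deg0r (alpha beta : diff_form) J :
  (forall I : {set 'I_n}, I != finset.set0 -> beta I = 0) ->
  wedge alpha beta J = alpha J * beta finset.set0.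
Proof.
move=> b0; rewrite /wedge (bigD1 J) //= big1 => [|I /andP[IJ neIJ]].
  rewrite finset.setDv addr0 /inversions (_ : [set ij | _]%SET = finset.set0).
    by rewrite cards0 expr0 mul1r.
  by apply/setP => ij; rewrite !inE andbF.
rewrite b0 ?mulr0 //; apply: contra neIJ.
by rewrite finset.setD_eq0 => JI; rewrite finset.eqEsubset IJ.
Qed.

Hypothesis partialF0 : forall i, partial F i 0 = 0.

Lemma ext_d_form0 (g : A) (J : {set 'I_n}) :
  ext_d (form0 g) J = \sum_(i < n | J == [set i]%SET) partial F i g.
Proof.
rewrite /ext_d [RHS]big_mkcond; apply: eq_bigr => i _; rewrite wedge_deg0r.
  by rewrite /dx /form0 eqxx; case: ifP; rewrite (mul1r, mul0r).
by move=> I /negPf I0; rewrite /form0 I0 partialF0.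
Qed.

Lemma ext_d_form0_deg (g : A) (J : {set 'I_n}) : #|J| != 1%N ->
  ext_d (form0 g) J = 0.
Proof.
move=> J1; rewrite ext_d_form0 big1 // => i /eqP JE.
by rewrite JE cards1 in J1.
Qed.

Lemma ext_d_form0_set1 (g : A) (i : 'I_n) :
  ext_d (form0 g) [set i]%SET = partial F i g.
Proof.
rewrite ext_d_form0 (big_pred1 i) // => j.
by rewrite (inj_eq (@finset.set1_inj _)) eq_sym.
Qed.

(* H^0 = {g | f dg + p g df = 0}. *)
Lemma H0E (f : A) (p : int) (g : A) : germs F 0 ->
  H0 f p g <-> germs F g /\
    forall i, f * partial F i g + (g * partial F i f) *~ p = 0.
Proof.
move=> F0.
have tdE J : twisted_d f p 0 (form0 g) J =
    f * ext_d (form0 g) J + (g * ext_d (form0 f) J) *~ p.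
  rewrite /twisted_d wedge_deg0r; last first.
    by move=> I; rewrite /form0 => /negPf ->.
  by rewrite /form0 eqxx sub0r mulrNz opprK mulrC [g * _]mulrC.
split=> [[[Fg _] cg]|[Fg cg]]; split.
- by move: (Fg finset.set0); rewrite /form0 eqxx.
- by move=> i; rewrite -(cg [set i]%SET) tdE !ext_d_form0_set1.
- split=> I; rewrite /form0; first by case: ifP.
  by rewrite cards_eq0 => /negPf ->.
- move=> J; rewrite tdE; have [/eqP/cards1P[i ->]|J1] := eqVneq #|J| 1%N.
    by rewrite !ext_d_form0_set1.
  by rewrite !ext_d_form0_deg // !mulr0 mul0rz addr0.
Qed.

End Cohomology.

Corollary H0_germs_in (R : realType) (C : category) (n : nat)
    (f : ambient (germs_in R C n)) (p : int) (g : ambient (germs_in R C n)) :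
  H0 f p g <-> germs (germs_in R C n) g /\
    forall i, f * partial (germs_in R C n) i g
              + (g * partial (germs_in R C n) i f) *~ p = 0.
Proof. by apply: H0E; [exact: partial0|exact: germs0]. Qed.

(* Main.v *)
Require Import Defs.
From mathcomp Require Import all_boot all_order all_algebra.
From mathcomp Require Import all_classical all_reals.
From mathcomp Require Import -(notations) mpoly.
From mathcomp Require Import finmap all_analysis complex.
From mathcomp.analysis.showcase Require Import summability.
From mathcomp Require Import ring lra.

Import Order.TTheory GRing.Theory Num.Theory.
Import numFieldNormedType.Exports.
Local Open Scope classical_set_scope.
Local Open Scope ring_scope.

Set Implicit Arguments.
Unset Strict Implicit.
Unset Printing Implicit Defensive.

(** A cocycle of degree 0 is a germ [g] with [f dg + p g df = 0]. Formally this
    says that [f ^ p g] has zero differential, so that [g] should be a constant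
    multiple of [f ^ (- p)]. The point is to justify this although [f ^ p g]
    is not a germ when [p < 0], and although the locus where [f] does not vanish
    need not be connected. Finite codimension enters through [f <> 0]
    ([finite_codimension_neq0]): the Jacobian ideal of the zero germ is zero.

    Formal series ([fps_solutions]). Let [x^a] and [x^b] be the lowest monomials
    of [f] and [g] for a monomial order. The Euler operators [x_i d/dx_i] act
    diagonally on monomials, so the lowest term of the equation reads
    [b_i + p a_i = 0] for all [i] ([lowest_solution]). If [p > 0], this
    forces [a = 0], against [f(0) = 0]. If [p <= 0], it determines [b], so a
    solution whose coefficient at [x^b] is zero vanishes; this applies to
    [g - c f ^ (- p)] for a suitable constant [c].

    Analytic germs ([analytic_solutions]). The coefficients of [g] form a formal
    solution: a power series may be differentiated termwise
    ([termwise_derive]), may be multiplied by the polynomial [f], and is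
    determined by its sum ([power_series_unique]). So the formal case
    applies. Real and complex scalars are treated together, over any number
    field that is complete in the sense of [complete_field].

    Smooth germs ([smooth_solutions]). If [p > 0], the function [f ^ p g] has zero
    partial derivatives, so it is constant, equal to its value [0] at the origin;
    thus [g] vanishes where [f] does not, which is a dense set. If
    [p = - k <= 0], the same argument shows only that [g / f ^ k] is locally
    constant on the open set where [f <> 0]. Choose iterated partial
    derivatives [D] that map the polynomial [f ^ k] to a nonzero constant [L].
    Where [g / f ^ k] takes the local value [c], one has [D g = c L] and the
    partial derivatives of [D g] vanish. By density and continuity they vanish
    on a whole ball, so [D g] is constant there and [c] is the same on all the
    components. *)

(** * Formal power series *)

Section Formal.
Variables (K : numFieldType) (n : nat).
Implicit Types (f g : fps K n) (P Q : mpoly n K) (m : multinom n).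

Lemma fps_mulE f g m : (f * g) m =
  \sum_(k : bmultinom n (mdeg m).+1 * bmultinom n (mdeg m).+1
         | m == mnm_add k.1 k.2) f k.1 * g k.2.
Proof. by []. Qed.

Lemma fps_scaleE (c : K) f m : (c *: f) m = c * f m.
Proof. by []. Qed.

Lemma fps_addE f g m : (f + g) m = f m + g m.
Proof. by []. Qed.

Lemma fps_mulrzE f (z : int) m : (f *~ z) m = f m *~ z.
Proof.
have N k : (f *+ k) m = f m *+ k.
  by elim: k => [|k IH]; rewrite ?mulr0n // !mulrS fps_addE IH.
by case: z => k; rewrite -?pmulrn ?NegzE ?mulrNz -?pmulrn -?N.
Qed.

Lemma fps_of_mpolyM P Q :
  fps_of_mpoly (P * Q) = fps_of_mpoly P * fps_of_mpoly Q.
Proof. by apply/funext => m; rewrite fps_mulE /fps_of_mpoly mcoeffM. Qed.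

Lemma fps_of_mpoly1 : fps_of_mpoly 1 = 1 :> fps K n.
Proof. by []. Qed.

Lemma fps_of_mpoly0 : fps_of_mpoly 0 = 0 :> fps K n.
Proof. by apply/funext => m; rewrite /fps_of_mpoly mcoeff0. Qed.

Lemma fps_of_mpolyZ (c : K) P : fps_of_mpoly (c *: P) = c *: fps_of_mpoly P.
Proof. by apply/funext => m; rewrite fps_scaleE /fps_of_mpoly mcoeffZ. Qed.

Lemma fps_of_mpolyD P Q :
  fps_of_mpoly (P + Q) = fps_of_mpoly P + fps_of_mpoly Q.
Proof. by apply/funext => m; rewrite fps_addE /fps_of_mpoly mcoeffD. Qed.

Lemma fps_of_mpolyX P k : fps_of_mpoly (P ^+ k) = fps_of_mpoly P ^+ k.
Proof. by elim: k => [|k IH]; rewrite ?exprS ?fps_of_mpolyM ?IH. Qed.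

Lemma fps_partial_mpoly (i : 'I_n) P :
  fps_partial i (fps_of_mpoly P) = fps_of_mpoly (mderiv i P).
Proof.
by apply/funext => m; rewrite /fps_partial /fps_of_mpoly mcoeff_mderiv mulr_natl.
Qed.

(** A product with a monomial is a shift of the coefficients, because the
    second factor of a splitting [a + k] of the exponent is determined. *)
Lemma fps_mulX (a : multinom n) f m :
  (fps_of_mpoly (mpolyX K a) * f) m = if lem a m then f (mnm_sub m a) else 0.
Proof.
rewrite fps_mulE; case: ifPn => am; last first.
  rewrite big1 // => -[k1 k2] /= /eqP e; rewrite /fps_of_mpoly mcoeffX.
  case: eqP => [ek|_]; last by rewrite mul0r.
  by case/negP: am; rewrite e -ek lem_addr.
have d1 : (mdeg a < (mdeg m).+1)%N.
  by rewrite ltnS -[m](submK am) mdegD leq_addl.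
have d2 : (mdeg (mnm_sub m a) < (mdeg m).+1)%N.
  by rewrite ltnS -[in leqRHS](submK am) mdegD leq_addr.
rewrite (bigD1 (BMultinom d1, BMultinom d2)) /=; last first.
  by rewrite addmC submK.
rewrite /fps_of_mpoly mcoeffX eqxx mul1r big1 ?addr0 // => -[k1 k2] /=.
case/andP => /eqP e ne; rewrite mcoeffX; case: eqP => [ek|_]; last first.
  by rewrite mul0r.
case/eqP: ne; congr pair; apply: val_inj => //=.
by apply: (@addIm n a); rewrite submK // [LHS]addmC ek -e.
Qed.

(** Unlike the partial derivative, the Euler operator [x_i d/dx_i] does not shift
    exponents, which makes lowest terms easy to compare. *)
Lemma fps_euler (i : 'I_n) f m :
  (fps_of_mpoly (mpolyX K (mnm1 i)) * fps_partial i f) m = (m i)%:R * f m.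
Proof.
rewrite fps_mulX; case: ifPn => im.
  rewrite /fps_partial submK // mnmBE mnm1E eqxx subn1.
  by move/mnm_lepP/(_ i): im; rewrite mnm1E eqxx => /prednK ->.
suff -> : m i = 0%N by rewrite mul0r.
apply/eqP; rewrite -leqn0 leqNgt; apply: contra im => mi.
by apply/mnm_lepP => j; rewrite mnm1E; case: eqP => [<-|].
Qed.

Definition lowest f m := f m != 0 /\ forall m', (m' < m)%O -> f m' = 0.

Lemma lowest_exists f : f != 0 -> exists m, lowest f m.
Proof.
move=> f0; apply: contrapT => no; case/eqP: f0; apply/funext => m.
elim/(well_founded_ind (@ltom_wf n)): m => m IH.
by apply: contrapT => fm; apply: no; exists m; split => //; exact/eqP.
Qed.

(** Exponents smaller than [a] and [b] do not contribute, and the monomial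
    order is compatible with addition: the only splitting of [a + b] that
    contributes is the obvious one. *)
Lemma fps_mul_low f g (a b : multinom n) :
  (forall m, (m < a)%O -> f m = 0) -> (forall m, (m < b)%O -> g m = 0) ->
  (forall m, (m < mnm_add a b)%O -> (f * g) m = 0) /\
  (f * g) (mnm_add a b) = f a * g b.
Proof.
move=> fa gb; split=> [m mab|].
  rewrite fps_mulE big1 // => -[k1 k2] /= /eqP e.
  have [/fa ->|ak] := ltP (bmnm k1) a; first by rewrite mul0r.
  have [/gb ->|bk] := ltP (bmnm k2) b; first by rewrite mulr0.
  suff : (mnm_add a b <= m)%O by rewrite leNgt mab.
  by rewrite e; apply: lem_add.
have d1 : (mdeg a < (mdeg (mnm_add a b)).+1)%N by rewrite ltnS mdegD leq_addr.
have d2 : (mdeg b < (mdeg (mnm_add a b)).+1)%N by rewrite ltnS mdegD leq_addl.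
rewrite fps_mulE (bigD1 (BMultinom d1, BMultinom d2)) //= big1 ?addr0 //.
move=> -[k1 k2] /= /andP[/eqP e ne].
have [/fa ->|ak] := ltP (bmnm k1) a; first by rewrite mul0r.
have [/gb ->|bk] := ltP (bmnm k2) b; first by rewrite mulr0.
move: ak; rewrite le_eqVlt => /orP[/eqP ek|ak].
  case/eqP: ne; congr pair; apply: val_inj => //=.
  by apply: (@addmI n a); rewrite [RHS]e -ek.
by have := ltmc_le_add ak bk; rewrite -e ltxx.
Qed.

Lemma lowest_exp f (a : multinom n) k : lowest f a ->
  lowest (f ^+ k) (mnm_muln a k).
Proof.
case=> fa0 fa; elim: k => [|k [IH0 IH]].
  rewrite mulm0n expr0; split.
    rewrite -fps_of_mpoly1 /fps_of_mpoly mcoeff1 eqxx; exact: oner_neq0.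
  by move=> m; rewrite ltNge le0m.
have [l e] := fps_mul_low fa IH.
by rewrite mulmS exprS; split => //; rewrite e mulf_neq0.
Qed.

(** After multiplication by [x_i] the equation only involves Euler operators, and
    its coefficient at the monomial [a + b] is the product of the lowest
    coefficients of [f] and [g] by [b_i + p a_i]. *)
Lemma lowest_solution f g (p : int) (a b : multinom n) :
  (forall i, f * fps_partial i g + (g * fps_partial i f) *~ p = 0) ->
  lowest f a -> lowest g b -> forall i, (b i)%:Z + p * (a i)%:Z = 0.
Proof.
move=> eqn [fa0 fa] [gb0 gb] i; pose X := fps_of_mpoly (mpolyX K (mnm1 i)).
have E : f * (X * fps_partial i g) + ((X * fps_partial i f) * g) *~ p = 0.
  rewrite -[RHS](mulr0 X) -(eqn i) mulrDr mulrzAr mulrCA; congr (_ + _ *~ p).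
  by rewrite mulrCA mulrC mulrA.
have Ef m : (m < a)%O -> (X * fps_partial i f) m = 0.
  by move=> /fa fm; rewrite fps_euler fm mulr0.
have Eg m : (m < b)%O -> (X * fps_partial i g) m = 0.
  by move=> /gb gm; rewrite fps_euler gm mulr0.
have := congr1 (fun h : fps K n => h (mnm_add a b)) E.
rewrite fps_addE fps_mulrzE (fps_mul_low fa Eg).2 (fps_mul_low Ef gb).2.
rewrite !fps_euler -[RHS]/0.
have -> : f a * ((b i)%:R * g b) + (a i)%:R * f a * g b *~ p =
   f a * g b * ((b i)%:Z + p * (a i)%:Z)%:~R.
  by rewrite intrD intrM -!pmulrn -mulrzr; ring.
by move/eqP; rewrite !mulf_eq0 (negPf fa0) (negPf gb0) /= intr_eq0 => /eqP.
Qed.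

Lemma mderivXn (i : 'I_n) P k : mderiv i (P ^+ k) = P ^+ k.-1 * mderiv i P *+ k.
Proof.
elim: k => [|k IH]; first by rewrite expr0 mderivC mulr0n.
rewrite exprS mderivM IH mulrnAr mulrA -exprS mulrS mulrC.
by case: k {IH} => [|k] //=; rewrite !mulr0n.
Qed.

Lemma exp_solution (i : 'I_n) P (p : int) : p <= 0 ->
  P * mderiv i (P ^+ `|p|%N) + (P ^+ `|p|%N * mderiv i P) *~ p = 0.
Proof.
move=> p0; have : p = - `|p|%N%:Z by rewrite abszE ler0_norm ?opprK.
move: `|p|%N => k ->; rewrite mderivXn mulrNz -pmulrn mulrnAr mulrA.
case: k => [|k] /=; first by rewrite !mulr0n subr0.
by rewrite -exprS subrr.
Qed.

(** For [p <= 0], all nonzero solutions have the same lowest monomial, that of the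
    power of [P]. Subtracting the multiple of this power that has the same
    coefficient there leaves a solution without that monomial, which is [0]. *)
Theorem fps_solutions P (g : fps K n) (p : int) : P != 0 ->
  (forall i, fps_of_mpoly P * fps_partial i g +
     (g * fps_partial i (fps_of_mpoly P)) *~ p = 0) ->
  (0 < p -> mcoeff mnm0 P = 0 -> g = 0) /\
  (p <= 0 -> exists c : K, g = c *: fps_of_mpoly (P ^+ `|p|%N)).
Proof.
move=> P0 eqn; have [a la] : exists m, lowest (fps_of_mpoly P) m.
  apply: lowest_exists; apply: contra P0 => /eqP e0; apply/eqP/mpolyP => m.
  by rewrite mcoeff0 -[LHS]/(fps_of_mpoly P m) e0.
split=> [p0 P00|p0].
  apply: contrapT => /eqP/lowest_exists[b lb].
  (* A sum of natural numbers [b_i + p a_i] is zero only if [a_i] is. *)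
  have a0 : a = mnm0.
    apply/mnmP => i; rewrite mnm0E; apply/eqP.
    have /eqP := lowest_solution eqn la lb i.
    rewrite paddr_eq0 //; last by rewrite mulr_ge0 // ltW.
    by rewrite mulf_eq0 (gt_eqF p0) /= => /andP[].
  by case: la; rewrite /fps_of_mpoly a0 P00 eqxx.
have [lk0 _] := lowest_exp `|p|%N la.
set k := `|p|%N in lk0 *; set F := fps_of_mpoly P in eqn la lk0 *.
pose c := g (mnm_muln a k) / (F ^+ k) (mnm_muln a k).
exists c; rewrite fps_of_mpolyX -/F; apply/eqP; rewrite -subr_eq0.
apply: contraT => /lowest_exists[b lb].
have D (u v : fps K n) i : fps_partial i (u - c *: v) =
    fps_partial i u - c *: fps_partial i v.
  apply/funext => m; rewrite /fps_partial.
  rewrite -[LHS]/(_ * (u _ - c * v _)) -[RHS]/(_ * u _ - c * (_ * v _)).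
  by ring.
have eqn' i : F * fps_partial i (g - c *: F ^+ k) +
    ((g - c *: F ^+ k) * fps_partial i F) *~ p = 0.
  have := congr1 (@fps_of_mpoly K n) (exp_solution i P p0).
  rewrite fps_of_mpolyD; have -> : (P ^+ k * mderiv i P) *~ p =
      p%:~R *: (P ^+ k * mderiv i P) by rewrite scaler_int.
  rewrite fps_of_mpolyZ scaler_int !fps_of_mpolyM -!fps_partial_mpoly.
  rewrite fps_of_mpolyX -/k -/F => eqF.
  rewrite D mulrBr mulrBl mulrzBl addrACA eqn -scalerAr -scalerAl.
  have -> : - (c *: (F * fps_partial i (F ^+ k))) -
     (c *: (F ^+ k * fps_partial i F)) *~ p = - (c *:
     (F * fps_partial i (F ^+ k) + (F ^+ k * fps_partial i F) *~ p)).
    by rewrite scalerDr opprD scalerMzr.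
  by rewrite eqF fps_of_mpoly0 scaler0 oppr0 addr0.
have be : b = mnm_muln a k.
  apply/mnmP => i; have := lowest_solution eqn' la lb i.
  have -> : p = - k%:Z by rewrite abszE ler0_norm ?opprK.
  rewrite mulmnE mulNr => /eqP.
  by rewrite subr_eq0 -PoszM => /eqP[->]; rewrite mulnC.
case: lb => /eqP[]; rewrite be -[LHS]/(_ - c * (F ^+ k) (mnm_muln a k)).
by rewrite divfK ?subrr.
Qed.

End Formal.

(** * Unconditional sums *)

Section Sums.
Variables (K : numFieldType) (T : choiceType).
Implicit Types (u v : T -> K) (l : K) (A B : {fset T}).

Lemma partial_sumE u A : partial_sum u A = \sum_(m <- A) u m.
Proof. by rewrite big_seq_fsetE. Qed.

Lemma sum_cvgP u l : partial_sum u @ totally --> l <->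
  forall e, 0 < e -> exists A, forall B, (A `<=` B)%fset ->
    `|l - \sum_(m <- B) u m| <= e.
Proof.
have FT : Filter (@totally T) by exact: (@filter_filter _ _ totally_filter).
split=> [/cvgrPdist_le ul e /ul[A _ Ae]|ul].
  by exists A => B AB; rewrite -partial_sumE; exact: Ae.
apply/cvgrPdist_le => e /ul[A Ae]; exists A => // B AB.
by rewrite partial_sumE; exact: Ae.
Qed.

Lemma sum_eq u v l : u =1 v ->
  partial_sum u @ totally --> l -> partial_sum v @ totally --> l.
Proof. by move=> /funext ->. Qed.

Lemma sum_single u m : (forall m', m' != m -> u m' = 0) ->
  partial_sum u @ totally --> u m.
Proof.
move=> um; apply/sum_cvgP => e e0; exists [fset m]%fset => B.
rewrite fsub1set => mB; rewrite (big_fsetD1 m) //= big1_fset ?addr0.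
  by rewrite subrr normr0 ltW.
by move=> m'; rewrite !inE => /andP[m'm _] _; exact: um.
Qed.

Lemma sum_add u v l l' :
  partial_sum u @ totally --> l -> partial_sum v @ totally --> l' ->
  partial_sum (fun m => u m + v m) @ totally --> l + l'.
Proof.
move=> ul vl; have -> : partial_sum (fun m => u m + v m) =
    partial_sum u \+ partial_sum v.
  by apply/funext => A; rewrite /partial_sum big_split.
by apply: cvgD => //; exact: totally_filter.
Qed.

Lemma sum_scale (c : K) u l : partial_sum u @ totally --> l ->
  partial_sum (fun m => c * u m) @ totally --> c * l.
Proof.
move=> ul; have -> : partial_sum (fun m => c * u m) =
    (fun A => c * partial_sum u A).
  by apply/funext => A; rewrite /partial_sum mulr_sumr.
have FT : Filter (@totally T) by exact: (@filter_filter _ _ totally_filter).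
exact: (cvgM (cvg_cst c) ul).
Qed.

Lemma sum_unique u l l' :
  partial_sum u @ totally --> l -> partial_sum u @ totally --> l' -> l = l'.
Proof.
move=> ul ul'; have FT : ProperFilter (partial_sum u @ totally).
  by apply: fmap_proper_filter; exact: totally_filter.
exact: (@norm_cvg_unique _ _ _ FT _ _ ul ul').
Qed.

Lemma sum_terms_bounded u l : partial_sum u @ totally --> l ->
  exists2 M, 0 <= M & forall m, `|u m| <= M.
Proof.
move=> /sum_cvgP/(_ 1 ltr01)[A A1].
have AS0 : 0 <= \sum_(m <- A) `|u m| by exact: sumr_ge0.
(* Outside [A], a term is the difference of two partial sums that are within
   [1] of [l]; inside [A], it is at most the sum of the norms. *)
exists (2 + \sum_(m <- A) `|u m|) => [|m]; first by rewrite addr_ge0.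
have [mA|mA] := boolP (m \in A).
  rewrite (big_fsetD1 m) //= addrCA lerDl addr_ge0 //.
  exact: sumr_ge0.
have := A1 _ (fsubsetU1 m A); rewrite big_fsetU1 //= => b1.
have b2 := A1 _ (fsubset_refl A).
have -> : u m = l - \sum_(i <- A) u i - (l - (u m + \sum_(i <- A) u i)).
  by ring.
rewrite (le_trans (ler_normB _ _)) // (le_trans (lerD b2 b1)) //.
by rewrite lerDl.
Qed.

(** Used with translations of the exponents: multiplication by a monomial and
    differentiation both translate the coefficients. *)
Lemma sum_reindex u (s t : T -> T) l : cancel s t ->
  (forall m, u m != 0 -> s (t m) = m) ->
  partial_sum u @ totally --> l <-> partial_sum (u \o s) @ totally --> l.
Proof.
move=> st us.
(* A finite sum of [u \o s] is a finite sum of [u] as soon as the index sets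
   correspond to each other up to indices at which [u] vanishes. *)
have E A B : (forall m, m \in B -> s m \in A) ->
    (forall m, m \in A -> u m != 0 -> t m \in B) ->
    \sum_(m <- A) u m = \sum_(m <- B) u (s m).
  move=> BA AB; have <- : \sum_(m <- [fset s m | m in B]%fset) u m =
      \sum_(m <- B) u (s m).
    by rewrite big_imfset //= => x y _ _; exact: (can_inj st).
  apply/esym/big_fset_incl => [|m mA mB].
    by apply/fsubsetP => _ /imfsetP[m mB ->]; exact: BA.
  apply: contraNeq mB => um; apply/imfsetP; exists (t m) => /=.
    exact: AB.
  by rewrite us.
split=> /sum_cvgP ul; apply/sum_cvgP => e /ul[A Ae].
- exists [fset t m | m in A]%fset => B AB.
  have := Ae (A `|` [fset s m | m in B])%fset (fsubsetUl _ _).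
  rewrite (E _ B) // => m; first by move=> mB; rewrite inE in_imfset ?orbT.
  rewrite inE => /orP[mA _|/imfsetP[k kB ->] _]; last by rewrite st.
  by apply: (fsubsetP AB); rewrite in_imfset.
- exists [fset s m | m in A]%fset => B AB.
  have := Ae [fset t m | m in B & s (t m) == m]%fset.
  rewrite (E B [fset t m | m in B & s (t m) == m]%fset); first apply.
  + apply/fsubsetP => m mA; apply/imfsetP; exists (s m); last by rewrite st.
    by rewrite !inE st eqxx andbT; apply: (fsubsetP AB); rewrite in_imfset.
  + by move=> m /imfsetP[k]; rewrite !inE => /andP[kB /eqP ek] ->; rewrite ek.
  + by move=> m mB um; apply/imfsetP; exists m; rewrite // !inE mB us // eqxx.
Qed.

End Sums.

(** * Sums of power series in several variables *)

Section PowerSeries.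
Variables (K : numFieldType) (n : nat).
Local Notation V := 'rV[K]_n.
Local Notation T := (multinom n).
Implicit Types (a : fps K n) (x : V) (m : T).

Definition mon x m : K := \prod_(i < n) x 0 i ^+ m i.

Definition sums_to a x (l : K) :=
  partial_sum (fun m => a m * mon x m) @ totally --> l.

Lemma monD x m m' : mon x (mnm_add m m') = mon x m * mon x m'.
Proof.
by rewrite /mon -big_split; apply: eq_bigr => i _; rewrite mnmDE exprD.
Qed.

Lemma mon0 m : mon 0 m = (m == mnm0)%:R.
Proof.
case: eqP => [->|/eqP m0].
  by rewrite /mon big1 // => i _; rewrite mnm0E expr0.
have [i mi] : exists i, m i != 0%N.
  apply: contrapT => no; case/eqP: m0; apply/mnmP => i; rewrite mnm0E.
  by apply: contrapT => /eqP mi; apply: no; exists i.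
by rewrite /mon (bigD1 i) //= mxE expr0n (negPf mi) mul0r.
Qed.

Lemma meval_mpolyX x m : meval (x 0) (mpolyX K m) = mon x m.
Proof. by rewrite mevalX. Qed.

Lemma sums_to_1 x : sums_to 1 x 1.
Proof.
have h : 1 = (1 : fps K n) mnm0 * mon x mnm0.
  rewrite -[X in X * _]/(mcoeff mnm0 1) mcoeff1 eqxx mul1r.
  by rewrite /mon big1 // => i _; rewrite mnm0E expr0.
rewrite /sums_to [X in _ --> X]h; apply: sum_single => m /negPf m0.
by rewrite -[X in X * _]/(mcoeff m 1) mcoeff1 m0 mul0r.
Qed.

Lemma sums_to_at0 a l : sums_to a 0 l -> l = a mnm0.
Proof.
move=> al; apply: (sum_unique al).
have -> : a mnm0 = a mnm0 * mon 0 mnm0 by rewrite mon0 eqxx mulr1.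
by apply: sum_single => m /negPf m0; rewrite mon0 m0 mulr0.
Qed.

Lemma sums_toD a b x l l' : sums_to a x l -> sums_to b x l' ->
  sums_to (a + b) x (l + l').
Proof.
by move=> al bl; apply: sum_eq (sum_add al bl) => m; rewrite -mulrDl.
Qed.

Lemma sums_toZ (c : K) a x l : sums_to a x l -> sums_to (c *: a) x (c * l).
Proof.
by move=> al; apply: sum_eq (sum_scale al) => m; rewrite mulrA.
Qed.

Lemma sums_to_mulX (k : T) a x l : sums_to a x l ->
  sums_to (fps_of_mpoly (mpolyX K k) * a) x (mon x k * l).
Proof.
move=> al; rewrite /sums_to.
apply/(@sum_reindex _ _ _ (mnm_add k) (fun m => mnm_sub m k)).
- by move=> m; rewrite addmC addmK.
- move=> m; rewrite fps_mulX; case: ifP => [km _|]; last by rewrite mul0r eqxx.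
  by rewrite addmC submK.
apply: sum_eq (sum_scale al) => m /=.
by rewrite fps_mulX lem_addr monD [in RHS]mulrCA addmC addmK.
Qed.

Lemma sums_to_mulP (P : mpoly n K) a x l : sums_to a x l ->
  sums_to (fps_of_mpoly P * a) x (meval (x 0) P * l).
Proof.
move=> al; elim/mpolyind: P => [|c m P _ _ IH].
  rewrite meval0 mul0r (_ : fps_of_mpoly 0 = 0) ?mul0r; last first.
    by apply/funext => m; rewrite /fps_of_mpoly mcoeff0.
  by have := sums_toZ (c := 0) al; rewrite scale0r mul0r.
rewrite mevalD mevalZ meval_mpolyX fps_of_mpolyD fps_of_mpolyZ !mulrDl.
apply: sums_toD => //; rewrite -mulrA -scalerAl.
exact/sums_toZ/sums_to_mulX.
Qed.

Lemma sums_to_mpoly (P : mpoly n K) x :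
  sums_to (fps_of_mpoly P) x (meval (x 0) P).
Proof.
by have := sums_to_mulP (P := P) (sums_to_1 x); rewrite !mulr1.
Qed.

Lemma normr_coord x i : `|x 0 i| <= `|x|.
Proof.
rewrite [leRHS]/Num.norm /= mx_normE [leLHS](_ : _ = `|x 0 i|%:nng%:num) // num_le.
exact: (le_bigmax _ (fun j : 'I_1 * 'I_n => `|x j.1 j.2|%:nng) (0, i)).
Qed.

Lemma normr_rV_lt x r : 0 < r -> (forall i, `|x 0 i| < r) -> `|x| < r.
Proof.
move=> r0 xr; rewrite [ltLHS]/Num.norm /=.
have [->|/mx_norm_neq0[i ->]] := eqVneq (mx_norm x) 0; first by [].
by rewrite ord1 xr.
Qed.

Lemma nbhs0P (A : set V) : nbhs (0 : V) A <->
  exists2 r, 0 < r & forall x, `|x| < r -> A x.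
Proof.
split=> [/(@nbhs_norm0P K V)[r r0 rA]|[r r0 rA]]; first by exists r.
by apply/(@nbhs_norm0P K V); exists r.
Qed.

(** The components of the exponents in [A] are bounded by some [N], and the sum
    over all exponents with components below [N] is the [n]-th power of a partial
    sum of the geometric series. The bound does not depend on [A], so that no
    infinite sum is needed. *)
Lemma geometric_bound (q : K) (A : {fset T}) : 0 <= q < 1 ->
  \sum_(m <- A) q ^+ mdeg m <= (1 - q)^-1 ^+ n.
Proof.
case/andP=> q0 q1; pose N := (\sum_(m <- A) mdeg m).+1.
have q1' : 0 < 1 - q by rewrite subr_gt0.
have g N' : \sum_(k < N') q ^+ k <= (1 - q)^-1.
  rewrite -[leRHS]mul1r ler_pdivlMr // mulrC -opprB mulNr -subrX1 opprB.
  by rewrite lerBlDr lerDl exprn_ge0.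
pose e (f : {ffun 'I_n -> 'I_N}) : T := Multinom [tuple f i : nat | i < n].
have eE f i : e f i = f i by rewrite mnmE.
have e_inj : injective e.
  move=> f f' ff'; apply/ffunP => i; apply/val_inj => /=.
  by rewrite -!eE ff'.
have Ae m : m \in A -> exists f, e f = m.
  move=> mA; have mN i : (m i < N)%N.
    rewrite ltnS (big_fsetD1 m) //= (leq_trans _ (leq_addr _ _)) //.
    by rewrite mdegE (bigD1 i) //= leq_addr.
  exists [ffun i => Ordinal (mN i)]; apply/mnmP => i.
  by rewrite eE ffunE.
apply: (@le_trans _ _ (\sum_(f : {ffun 'I_n -> 'I_N}) q ^+ mdeg (e f))).
  rewrite [leRHS](_ : _ = \sum_(m <- [seq e f | f : {ffun 'I_n -> 'I_N}])
     q ^+ mdeg m); last by rewrite big_map big_enum.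
  set s := [seq _ | _ : _].
  have us : uniq s by rewrite map_inj_uniq ?enum_uniq.
  have As : perm_eq A [seq m <- s | m \in A].
    apply: uniq_perm; rewrite ?filter_uniq // => m.
    rewrite mem_filter; case mA: (m \in A) => //=; apply/esym.
    by have [f <-] := Ae m mA; rewrite map_f // mem_enum.
  rewrite (perm_big _ As) /= big_filter [leRHS](bigID (mem A)) /= lerDl.
  by apply: sumr_ge0 => m _; rewrite exprn_ge0.
rewrite (eq_bigr (fun f : {ffun 'I_n -> 'I_N} => \prod_i q ^+ f i)); last first.
  move=> f _; rewrite mdegE -prodrXr; apply: eq_bigr => i _.
  by rewrite eE.
rewrite -(bigA_distr_bigA (fun _ (k : 'I_N) => q ^+ k)) /=.
rewrite prodr_const card_ord; apply: lerXn2r; rewrite ?nnegrE ?g //.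
  by apply: sumr_ge0 => k _; rewrite exprn_ge0.
by rewrite invr_ge0 ltW.
Qed.

Definition taylor2 (k : nat) (z s : K) :=
  (z + s) ^+ k - z ^+ k - k%:R * s * z ^+ k.-1.

Lemma taylor2S k z s :
  taylor2 k.+1 z s = (z + s) * taylor2 k z s + k%:R * s ^+ 2 * z ^+ k.-1.
Proof.
rewrite /taylor2 !exprS; case: k => [|k] /=; first by rewrite !expr0; ring.
by rewrite !exprS -!natr1; ring.
Qed.

(** The remainder is [s ^+ 2] times a polynomial in [z] and [s] with nonnegative
    coefficients, so that replacing [z] by its norm and [s] by the larger
    increment [d] bounds it up to the factor [(`|s| / d) ^+ 2]. The proof by
    recurrence avoids writing this polynomial down. *)
Lemma taylor2_bound k (z s d : K) : 0 < d -> `|s| <= d ->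
  `|taylor2 k z s| <= (`|s| / d) ^+ 2 * (`|z| + d) ^+ k.
Proof.
move=> d0 sd; have d0' := ltW d0.
have c0 : 0 <= (`|s| / d) ^+ 2 by rewrite exprn_ge0 // divr_ge0.
apply: (@le_trans _ _ ((`|s| / d) ^+ 2 * taylor2 k `|z| d)); last first.
  apply: ler_wpM2l => //; rewrite /taylor2 -addrA gerDl -opprD oppr_le0.
  by rewrite addr_ge0 ?mulr_ge0 ?exprn_ge0 ?ler0n.
elim: k => [|k IH].
  by rewrite /taylor2 !expr0 subrr !mul0r subr0 normr0 mulr0.
rewrite !taylor2S [leRHS]mulrDr (le_trans (ler_normD _ _)) // lerD //.
  rewrite normrM mulrCA ler_pM // (le_trans (ler_normD _ _)) //.
  by rewrite lerD2l.
rewrite !normrM !normrX normr_nat.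
suff -> : (`|s| / d) ^+ 2 * (k%:R * d ^+ 2 * `|z| ^+ k.-1) =
  k%:R * `|s| ^+ 2 * `|z| ^+ k.-1 by [].
by field; rewrite gt_eqF.
Qed.

End PowerSeries.
(** * Termwise differentiation *)

(** The Cauchy criterion for functions of finite sets, which is the only form in
    which completeness is used. It is a hypothesis on the field, so that the same
    proofs serve for real and for complex scalars. *)
Definition complete_field (K : numFieldType) :=
  forall (I : choiceType) (u : {fset I} -> K),
    (forall e, 0 < e -> exists l A, forall B, (A `<=` B)%fset ->
      `|u B - l| <= e) -> exists l : K, u @ totally --> l.

Section TermwiseDerivative.
Variables (K : numFieldType) (n : nat).
Local Notation V := 'rV[K]_n.
Local Notation T := (multinom n).
Implicit Types (a : fps K n) (x : V) (m : T).

Lemma mon_increment x i m s d rho : 0 < d -> `|s| <= d ->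
  (forall j, `|x 0 j| + d <= rho) ->
  `|mon (s *: delta_mx 0 i + x) m - mon x m -
     s * ((m i)%:R * mon x (mnm_sub m (mnm1 i)))|
    <= (`|s| / d) ^+ 2 * rho ^+ mdeg m.
Proof.
move=> d0 sd xd.
pose Q := \prod_(j < n | j != i) x 0 j ^+ m j.
have -> : mon (s *: delta_mx 0 i + x) m = (x 0 i + s) ^+ m i * Q.
  rewrite /mon (bigD1 i) //= !mxE !eqxx mulr1 addrC; congr (_ * _).
  by apply: eq_bigr => j /negPf ji; rewrite !mxE ji andbF mulr0 add0r.
have -> : mon x m = x 0 i ^+ m i * Q by rewrite /mon (bigD1 i).
have -> : mon x (mnm_sub m (mnm1 i)) = x 0 i ^+ (m i).-1 * Q.
  rewrite /mon (bigD1 i) //= mnmBE mnm1E eqxx subn1; congr (_ * _).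
  by apply: eq_bigr => j ji; rewrite mnmBE mnm1E eq_sym (negPf ji) subn0.
have -> : (x 0 i + s) ^+ m i * Q - x 0 i ^+ m i * Q -
    s * ((m i)%:R * (x 0 i ^+ (m i).-1 * Q)) = taylor2 (m i) (x 0 i) s * Q.
  by rewrite /taylor2; ring.
rewrite normrM mdegE (bigD1 i) //= exprD mulrA ler_pM //.
  apply: (le_trans (taylor2_bound _ _ d0 sd)); apply: ler_wpM2l.
    by rewrite exprn_ge0 // divr_ge0 // ltW.
  by apply: lerXn2r; rewrite ?nnegrE ?addr_ge0 ?(le_trans _ (xd i)) ?addr_ge0
    // ltW.
rewrite normr_prod -prodrXr; apply: ler_prod => j _; rewrite normr_ge0 normrX.
have xj : `|x 0 j| <= rho by apply: le_trans (xd j); rewrite lerDl ltW.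
by apply: lerXn2r; rewrite ?nnegrE // (le_trans _ xj).
Qed.

(** Cauchy's estimate in its weakest form: the terms of the series at a point all
    of whose coordinates are [r'] are bounded. *)
Lemma sums_to_bounded a r h r' : 0 < r' < r ->
  (forall y : V, `|y| < r -> sums_to a y (h y)) ->
  exists2 M, 0 <= M & forall m, `|a m| * r' ^+ mdeg m <= M.
Proof.
case/andP=> r'0 r'r ah; have r0 := lt_trans r'0 r'r.
have : `|const_mx r' : V| < r.
  by apply: normr_rV_lt => // i; rewrite mxE gtr0_norm.
move=> /ah/sum_terms_bounded[M M0 aM]; exists M => // m.
rewrite -[r' ^+ _](_ : `|mon (const_mx r') m| = _) -?normrM //.
rewrite /mon (eq_bigr (fun i => r' ^+ m i)) => [|i _]; last by rewrite mxE.
by rewrite prodrXr -mdegE gtr0_norm // exprn_gt0.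
Qed.

Hypothesis complK : complete_field K.

(** The difference quotients of the partial sums differ from the partial sums
    of the termwise derivative by at most [C * `|s|], uniformly in the finite set
    of exponents: this gives at once the convergence of the derived series, by the
    Cauchy criterion, and the value of the derivative. *)
Theorem termwise_derive a r h x i :
  (forall y : V, `|y| < r -> sums_to a y (h y)) -> `|x| < r ->
  exists2 l, sums_to (fps_partial i a) x l & is_derive x (delta_mx 0 i) h l.
Proof.
move=> ah xr.
(* The increments are at most [d], so that coordinates stay below [rho], and the
   terms of the series are bounded at the larger radius [r'], still below [r]. *)
pose d := (r - `|x|) / 3%:R.
have d0 : 0 < d by rewrite divr_gt0 ?ltr0n // subr_gt0.
have rE : r = `|x| + d + d + d by rewrite /d; field.
pose rho := `|x| + d; pose r' := `|x| + d + d.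
have rho0 : 0 < rho by rewrite ltr_wpDl.
have rhor' : rho < r' by rewrite ltrDl.
have r'0 : 0 < r' by exact: lt_trans rhor'.
have r'r : r' < r by rewrite rE ltrDl.
have rhor : rho < r by exact: lt_trans r'r.
have [M M0 aM] := sums_to_bounded (introT andP (conj r'0 r'r)) ah.
pose q := rho / r'.
have q01 : 0 <= q < 1.
  by rewrite divr_ge0 ?ltW //= ltr_pdivrMr ?mul1r.
pose C := M * (1 - q)^-1 ^+ n / d ^+ 2.
have C0 : 0 <= C.
  apply: divr_ge0; last by rewrite exprn_ge0 // ltW.
  rewrite mulr_ge0 // exprn_ge0 // invr_ge0 subr_ge0.
  by case/andP: q01 => _ /ltW.
pose v : V := delta_mx 0 i.
pose u m := a m * ((m i)%:R * mon x (mnm_sub m (mnm1 i))).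
have xrho j : `|x 0 j| + d <= rho by rewrite lerD2r normr_coord.
have quot (A : {fset T}) s : s != 0 -> `|s| <= d ->
  `|s^-1 * \sum_(m <- A) (a m * mon (s *: v + x) m - a m * mon x m)
     - \sum_(m <- A) u m| <= `|s| * C.
  move=> s0 sd.
  have -> : s^-1 * \sum_(m <- A) (a m * mon (s *: v + x) m - a m * mon x m)
      - \sum_(m <- A) u m = s^-1 * \sum_(m <- A) a m *
     (mon (s *: v + x) m - mon x m -
      s * ((m i)%:R * mon x (mnm_sub m (mnm1 i)))).
    rewrite !mulr_sumr -sumrB; apply: eq_bigr => m _.
    by rewrite /u; field.
  rewrite normrM normfV ler_pdivrMl ?normr_gt0 //.
  apply: (le_trans (ler_norm_sum _ _ _)).
  apply: (@le_trans _ _ (\sum_(m <- A) (`|s| / d) ^+ 2 * M * q ^+ mdeg m)).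
    apply: ler_sum => m _; rewrite normrM.
    apply: (@le_trans _ _ (`|a m| * ((`|s| / d) ^+ 2 * rho ^+ mdeg m))).
      by rewrite ler_wpM2l // mon_increment.
    have -> : rho = q * r' by rewrite /q divfK // gt_eqF.
    have -> : `|a m| * ((`|s| / d) ^+ 2 * (q * r') ^+ mdeg m) =
        (`|s| / d) ^+ 2 * (`|a m| * r' ^+ mdeg m) * q ^+ mdeg m.
      by rewrite [(q * r') ^+ _]exprMn; ring.
    apply: ler_wpM2r; first by rewrite exprn_ge0 //; case/andP: q01.
    by apply: ler_wpM2l; rewrite // exprn_ge0 // divr_ge0 // ltW.
  rewrite -mulr_sumr.
  apply: (@le_trans _ _ ((`|s| / d) ^+ 2 * M * (1 - q)^-1 ^+ n)).
    apply: ler_wpM2l; last exact: geometric_bound.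
    by rewrite mulr_ge0 // exprn_ge0 // divr_ge0 // ltW.
  by rewrite le_eqVlt /C; apply/orP; left; apply/eqP; field; rewrite gt_eqF.
have near_quot s e : s != 0 -> `|s| <= d -> 0 < e ->
  exists A, forall B, (A `<=` B)%fset ->
  `|s^-1 * (h (s *: v + x) - h x) - \sum_(m <- B) u m| <= `|s| * C + e.
  move=> s0 sd e0.
  have sxr : `|s *: v + x| < r.
    apply: normr_rV_lt => [|j]; first by exact: lt_trans rhor.
    rewrite !mxE; apply: le_lt_trans rhor.
    apply: le_trans (xrho j); rewrite addrC (le_trans (ler_normD _ _)) // lerD2l.
    by rewrite normrM (le_trans _ sd) // ler_piMr // normr_nat lern1 leq_b1.
  have := sum_scale (c := s^-1) (sum_add (ah _ sxr) (sum_scale (c := -1) (ah _ xr))).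
  move=> /sum_cvgP/(_ e e0)[A hA]; exists A => B /hA.
  rewrite -mulr_sumr mulN1r => {}hA.
  have := quot B s s0 sd.
  set X := s^-1 * (_ - _) in hA *.
  set Y := s^-1 * _ in hA; set Y' := s^-1 * _; have -> : Y' = Y.
    by congr (_ * _); apply: eq_bigr => m _; rewrite mulN1r.
  move=> hY; have -> : X - \sum_(m <- B) u m = Y - \sum_(m <- B) u m + (X - Y).
    by ring.
  by rewrite (le_trans (ler_normD _ _)) // lerD.
(* Half a harmonic mean replaces the minimum of [d] and [e / (2 * C)], which need
   not be comparable a priori as the order is only partial. *)
pose step e := (d^-1 + (C + C) / e)^-1.
have stepP e : 0 < e -> [/\ 0 < step e, step e <= d & step e * C <= e / 2%:R].
  move=> e0; have s0 : 0 < d^-1 + (C + C) / e.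
    by rewrite ltr_wpDr ?invr_gt0 // divr_ge0 ?addr_ge0 // ltW.
  split; first by rewrite invr_gt0.
    by rewrite -[leRHS]invrK lef_pV2 ?posrE ?invr_gt0 // lerDl divr_ge0
      ?addr_ge0 // ltW.
  rewrite ler_pdivrMl // mulrDl.
  have -> : (C + C) / e * (e / 2%:R) = C by field; rewrite gt_eqF.
  by rewrite lerDr ltW // mulr_gt0 ?invr_gt0 // divr_gt0 ?ltr0n.
(* The difference quotient for the increment [step e] is the approximate limit
   that the Cauchy criterion asks for. *)
have [l ul] : exists l : K, partial_sum u @ totally --> l.
  apply: complK => e e0; have [s0 sd sC] := stepP e e0.
  have ns : `|step e| = step e by rewrite gtr0_norm.
  have e20 : 0 < e / 2%:R by rewrite divr_gt0 ?ltr0n.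
  have [||A hA] := @near_quot (step e) (e / 2%:R) _ _ e20.
  - by rewrite gt_eqF.
  - by rewrite ns.
  eexists; exists A => B /hA; rewrite distrC partial_sumE => /le_trans; apply.
  by rewrite ns [leRHS](splitr e) lerD2r.
exists l.
  apply/(sum_eq (u := u \o mnm_add (mnm1 i))).
    move=> m /=; rewrite /u /fps_partial [mnm_add _ m]addmC addmK mnmDE mnm1E.
    by rewrite eqxx addn1; ring.
  apply/(@sum_reindex _ _ u _ (fun m => mnm_sub m (mnm1 i))) => //.
  - by move=> m; rewrite addmC addmK.
  - move=> m; rewrite /u => um; rewrite addmC submK //.
    apply/mnm_lepP => j; rewrite mnm1E; case: eqP => [<-|//].
    by rewrite lt0n; apply: contraNneq um => ->; rewrite mul0r mulr0.
suff hl : (fun s => s^-1 *: (h (s *: v + x) - h x)) @ 0^' --> l.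
  by apply: DeriveDef; [exact: cvgP hl|exact: cvg_lim hl].
apply/cvgrPdist_le => e e0; have e20 : 0 < e / 2%:R by rewrite divr_gt0 ?ltr0n.
have e40 : 0 < e / 2%:R / 2%:R by rewrite divr_gt0 ?ltr0n.
have [s0 sd sC] := stepP e e0.
apply/(@nbhs_norm0P K K); exists (step e) => //= s ss sn0.
have [A1 hA1] := @near_quot s _ sn0 (ltW (lt_le_trans ss sd)) e40.
have /sum_cvgP/(_ _ e40)[A2 hA2] := ul.
have := hA1 _ (fsubsetUl A1 A2); have := hA2 _ (fsubsetUr A1 A2).
set S := \sum_(m <- _) _ => h2 h1.
have -> : l - s^-1 *: (h (s *: v + x) - h x) =
  l - S - (s^-1 * (h (s *: v + x) - h x) - S) by rewrite /GRing.scale /=; ring.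
rewrite (le_trans (ler_normB _ _)) // (le_trans (lerD h2 h1)) //.
have -> : e / 2%:R / 2%:R + (`|s| * C + e / 2%:R / 2%:R) = `|s| * C + e / 2%:R.
  by field.
rewrite [leRHS](splitr e) lerD2r (le_trans _ sC) // ler_wpM2r //.
exact: ltW.
Qed.

End TermwiseDerivative.

(** * Analytic germs *)

Section Completeness.
Variable R : realType.

Lemma complete_field_real : complete_field R.
Proof.
move=> I u hu; have FT : ProperFilter (u @ totally).
  by apply: fmap_proper_filter; exact: totally_filter.
suff : cvg (u @ totally) by move=> cu; exists (lim (u @ totally)).
apply: cauchy_cvg; apply: cauchy_exP => e e0.
have e20 : 0 < e / 2 by rewrite divr_gt0.
have [l [A hA]] := hu _ e20; exists l; exists A => // B /hA Be.
rewrite /ball /= distrC (le_lt_trans Be) // ltr_pdivrMr //.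
by rewrite mulr_natr mulr2n ltrDl.
Qed.

Lemma complex_norm_bounds (a b e : R) : `|(a +i* b)%C| <= (e%:C)%C ->
  `|a| <= e /\ `|b| <= e.
Proof.
rewrite normc_def lecR /= => h.
by split; apply: le_trans h; rewrite -sqrtr_sqr ler_wsqrtr // ?lerDl ?lerDr
  sqr_ge0.
Qed.

Lemma complex_norm_le (a b e : R) : `|a| <= e -> `|b| <= e ->
  `|(a +i* b)%C| <= ((e + e)%:C)%C.
Proof.
move=> ae be; have e0 : 0 <= e by apply: le_trans ae.
rewrite normc_def lecR /= -[leRHS]ger0_norm ?addr_ge0 // -sqrtr_sqr.
apply: ler_wsqrtr; rewrite -[a ^+ 2]real_normK ?num_real //.
rewrite -[b ^+ 2]real_normK ?num_real // sqrrD.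
apply: (@le_trans _ _ (e ^+ 2 + e ^+ 2)).
  by rewrite lerD // lerXn2r.
by rewrite lerD2r lerDl mulrn_wge0 // mulr_ge0.
Qed.

Lemma complete_field_complex : complete_field R[i].
Proof.
move=> I u hu.
have hR (p : R[i] -> R) : (forall x y, p (x - y) = p x - p y) ->
    (forall x e, `|x| <= (e%:C)%C -> `|p x| <= e) ->
    exists l : R, (p \o u) @ totally --> l.
  move=> pB pe; apply: complete_field_real => e e0.
  have [|l [A hA]] := hu (e%:C)%C; first by rewrite ltcR.
  by exists (p l), A => B /hA /pe; rewrite pB.
have [|| a ua] := hR (@complex.Re R).
- by move=> [x1 x2] [y1 y2].
- by move=> [x1 x2] e /complex_norm_bounds[].
have [|| b ub] := hR (@complex.Im R).
- by move=> [x1 x2] [y1 y2].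
- by move=> [x1 x2] e /complex_norm_bounds[].
have FT : Filter (@totally I) by exact: (@filter_filter _ _ totally_filter).
exists (a +i* b)%C; apply/cvgrPdist_le => e.
case: e => e1 e2; rewrite ltcE /= => /andP[/eqP -> e0].
have e20 : 0 < e1 / 2 by rewrite divr_gt0.
move/cvgrPdist_le/(_ _ e20): ua; move/cvgrPdist_le/(_ _ e20): ub.
apply: filterS2 => B /= ; case: (u B) => x y /= h2 h1.
by rewrite [e1]splitr; exact: complex_norm_le.
Qed.

Lemma complete_scalars (C : category) : complete_field (scalars R C).
Proof.
by case: C; first [exact: complete_field_real|exact: complete_field_complex].
Qed.

End Completeness.

Section AnalyticGerms.
Variables (K : numFieldType) (n : nat).
Local Notation V := 'rV[K]_n.
Implicit Types (P Q : mpoly n K) (a : fps K n) (h : V -> K) (x : V).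

Definition poly_fun P : V -> K := fun x => meval (x 0) P.

Lemma germ_of_mpolyD P Q :
  germ_of_mpoly (P + Q) = germ_of_mpoly P + germ_of_mpoly Q.
Proof.
by rewrite -germ_ofD; congr germ_of; apply/funext => x; rewrite mevalD.
Qed.

Lemma germ_of_mpolyM P Q :
  germ_of_mpoly (P * Q) = germ_of_mpoly P * germ_of_mpoly Q.
Proof.
by rewrite -germ_ofM; congr germ_of; apply/funext => x; rewrite mevalM.
Qed.

Lemma germ_of_mpolyZ (c : K) P : germ_of_mpoly (c *: P) = c *: germ_of_mpoly P.
Proof.
by rewrite -germ_ofZ; congr germ_of; apply/funext => x; rewrite mevalZ.
Qed.

Lemma germ_of_mpoly1 : germ_of_mpoly 1 = 1 :> fun_germ K n.
Proof.
by rewrite -germ_of1; congr germ_of; apply/funext => x; rewrite meval1.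
Qed.

Hypothesis complK : complete_field K.

Lemma is_derive_poly (i : 'I_n) P x :
  is_derive x (delta_mx 0 i) (poly_fun P) (poly_fun (mderiv i P) x).
Proof.
have xr : `|x| < `|x| + 1 by rewrite ltrDl.
have [l Pl Pd] := termwise_derive complK i
  (fun y (_ : `|y| < `|x| + 1) => @sums_to_mpoly K n P y) xr.
suff -> : poly_fun (mderiv i P) x = l by [].
apply: sum_unique Pl; rewrite fps_partial_mpoly; exact: sums_to_mpoly.
Qed.

Lemma fun_partial_poly (i : 'I_n) P :
  fun_partial i (poly_fun P) = poly_fun (mderiv i P).
Proof. by apply/funext => x; apply: derive_val; exact: is_derive_poly. Qed.

Lemma germ_partial_mpoly (i : 'I_n) P :
  germ_partial i (germ_of_mpoly P) = germ_of_mpoly (mderiv i P).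
Proof. by rewrite germ_partialE -[fun _ => _]/(poly_fun P) fun_partial_poly. Qed.

(** The constant term is the value at the origin, and the other coefficients are
    constant terms of derivatives. *)
Lemma power_series_unique a r : 0 < r ->
  (forall x : V, `|x| < r -> sums_to a x 0) -> a = 0.
Proof.
move=> r0 a0; apply/funext => m; move: {2}(mdeg m) (erefl (mdeg m)) => d.
elim: d m a a0 => [|d IH] m a a0 md.
  have /eqP -> : m == mnm0 by rewrite -mdeg_eq0 md.
  by apply/esym/sums_to_at0/a0; rewrite normr0.
have [i mi] : exists i, (0 < m i)%N.
  apply: contrapT => no; move: md; rewrite mdegE big1 // => i _.
  by apply/eqP; rewrite -leqn0 leqNgt; apply/negP => mi; apply: no; exists i.
have im : lem (mnm1 i) m.
  by apply/mnm_lepP => j; rewrite mnm1E; case: eqP => // <-.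
have : fps_partial i a (mnm_sub m (mnm1 i)) = 0.
  apply: IH => [x xr|]; last first.
    by apply/eqP; rewrite -eqSS -md -{2}(submK im) mdegD mdeg1 addn1.
  have [l al hl] := termwise_derive complK i (h := fun=> 0) a0 xr.
  by rewrite -[0](derive_cst (0 : K) x (delta_mx 0 i)) (@derive_val _ _ _ _ _ _ _ hl).
rewrite /fps_partial submK // => /eqP; rewrite mulf_eq0 pnatr_eq0 /=.
by move/eqP.
Qed.

Lemma germ_of_mpoly_eq0 P : germ_of_mpoly P = 0 -> P = 0.
Proof.
rewrite -germ_of0 => /germ_ofP/nbhs0P[r r0 P0]; apply/mpolyP => m.
rewrite mcoeff0 -[LHS]/(fps_of_mpoly P m).
rewrite (@power_series_unique (fps_of_mpoly P) r) // => x xr.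
have -> : 0 = meval (x 0) P by apply/esym; exact: P0.
exact: sums_to_mpoly.
Qed.

Lemma analytic_germ_mpoly P : germs (analytic_germs K n) (germ_of_mpoly P).
Proof.
exists (poly_fun P) => //; exists (fps_of_mpoly P).
by apply: (filterE (nbhs_filter _)) => x; exact: sums_to_mpoly.
Qed.

(** Both sides of the equation are sums of power series, whose coefficients are
    those of the equation for the formal series of coefficients of the solution;
    uniqueness of the coefficients reduces the problem to formal series. *)
Theorem analytic_solutions P (g : fun_germ K n) (p : int) : P != 0 ->
  germs (analytic_germs K n) g ->
  (forall i, germ_of_mpoly P * germ_partial i g +
     (g * germ_partial i (germ_of_mpoly P)) *~ p = 0) ->
  (0 < p -> mcoeff mnm0 P = 0 -> g = 0) /\
  (p <= 0 -> exists c : K, g = c *: germ_of_mpoly (P ^+ `|p|%N)).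
Proof.
move=> P0 [h [a0 /nbhs0P[r r0 ah0]] <-] eqn.
(* The type [fps K n] selects the Cauchy product instead of the pointwise one. *)
pose a : fps K n := a0.
have {ah0} ah x : `|x| < r -> sums_to a x (h x) by exact: ah0.
have eqa i : fps_of_mpoly P * fps_partial i a +
    (a * fps_partial i (fps_of_mpoly P)) *~ p = 0.
  have := eqn i; rewrite germ_partial_mpoly germ_partialE -scaler_int.
  rewrite -!germ_ofM -germ_ofZ -germ_ofD -germ_of0 => /germ_ofP/nbhs0P[s s0 eqh].
  (* A positive number below both [r] and [s]. *)
  have rs0 : 0 < r * s / (r + s) by rewrite divr_gt0 ?mulr_gt0 ?addr_gt0.
  apply: (power_series_unique rs0) => x xrs.
  have xr : `|x| < r.
    apply: lt_le_trans xrs _; rewrite ler_pdivrMr ?addr_gt0 //.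
    by rewrite mulrDr lerDr mulr_ge0 ?ltW.
  have xs : `|x| < s.
    apply: lt_le_trans xrs _; rewrite ler_pdivrMr ?addr_gt0 // mulrDr.
    by rewrite [r * s]mulrC lerDl mulr_ge0 ?ltW.
  have -> : 0 = poly_fun P x * fun_partial i h x +
      p%:~R * (h x * poly_fun (mderiv i P) x) :> K by apply/esym/(eqh x xs).
  rewrite -scaler_int.
  apply: sums_toD; last apply: sums_toZ.
    have [l al hl] := termwise_derive complK i ah xr.
    apply: sums_to_mulP; rewrite /fun_partial.
    by rewrite (@derive_val _ _ _ _ _ _ _ hl).
  rewrite fps_partial_mpoly [a * _]mulrC [h x * _]mulrC.
  exact: sums_to_mulP (ah x xr).
have [h1 h2] := fps_solutions P0 eqa; split=> [p0 P00|p0].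
  rewrite -germ_of0; apply/germ_ofP/nbhs0P; exists r => // x xr.
  apply: (sum_unique (ah x xr)); rewrite (h1 p0 P00).
  have := sums_toZ (c := 0) (ah x xr); rewrite scale0r mul0r; exact.
have [c ac] := h2 p0; exists c; rewrite -germ_ofZ.
apply/germ_ofP/nbhs0P; exists r => // x xr.
apply: (sum_unique (ah x xr)); rewrite ac; apply: sums_toZ.
exact: sums_to_mpoly.
Qed.

End AnalyticGerms.

(** * Smooth germs *)

Section SmoothGerms.
Variables (R : realType) (n : nat).
Local Notation V := 'rV[R]_n.
Implicit Types (P Q : mpoly n R) (h : V -> R) (x y z : V) (s : seq 'I_n).

Lemma continuous_poly P : continuous (poly_fun P).
Proof.
have C1 : continuous (poly_fun (1 : mpoly n R)).
  rewrite (_ : poly_fun 1 = cst 1); first exact: cst_continuous.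
  by apply/funext => x; exact: meval1.
have CM Q1 Q2 : continuous (poly_fun Q1) -> continuous (poly_fun Q2) ->
    continuous (poly_fun (Q1 * Q2)).
  move=> c1 c2 x; rewrite (_ : poly_fun (Q1 * Q2) = poly_fun Q1 * poly_fun Q2).
    exact: (cvgM (c1 x) (c2 x)).
  by apply/funext => y; exact: mevalM.
have CX (m : multinom n) : continuous (poly_fun (mpolyX R m)).
  suff CP (s : seq 'I_n) :
      continuous (poly_fun (\prod_(i <- s) mpolyX R (mnm1 i) ^+ m i)).
    by rewrite mpolyXE_id; exact: CP.
  elim: s => [|i s IHs]; first by rewrite big_nil.
  rewrite big_cons; apply: (CM _ _ _ IHs).
  elim: (m i) => [|k IH]; rewrite ?expr0 ?exprS //; apply: CM => // x.
  rewrite (_ : poly_fun _ = fun M : V => M 0 i); first exact: coord_continuous.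
  by apply/funext => y; exact: mevalXU.
elim/mpolyind: P => [|c m P _ _ IH] x.
  rewrite (_ : poly_fun 0 = cst 0); first exact: cst_continuous.
  by apply/funext => y; exact: meval0.
rewrite (_ : poly_fun _ = (fun y => c * poly_fun (mpolyX R m) y + poly_fun P y)).
  exact: (cvgD (cvgM (cvg_cst c) (CX m x)) (IH x)).
by apply/funext => y; rewrite /poly_fun mevalD mevalZ.
Qed.

Lemma foldr_partial_poly P s :
  foldr (@fun_partial R n) (poly_fun P) s =
  poly_fun (foldr (mderiv (R := R)) P s).
Proof.
elim: s => //= i s ->; apply: fun_partial_poly; exact: complete_field_real.
Qed.

Lemma smooth_germ_mpoly P : germs (smooth_germs R n) (germ_of_mpoly P).
Proof.
exists (poly_fun P) => //; apply: (filterE (nbhs_filter _)) => x s.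
rewrite foldr_partial_poly; split=> [|i]; first exact: continuous_poly.
by have [] := is_derive_poly (@complete_field_real R) i
  (foldr (mderiv (R := R)) P s) x.
Qed.

Lemma foldr_partial_near h1 h2 s x :
  (\forall y \near x, h1 y = h2 y) ->
  \forall y \near x,
    foldr (@fun_partial R n) h1 s y = foldr (@fun_partial R n) h2 s y.
Proof.
move=> h12; elim: s => //= i s /near_join; apply: filterS => y.
exact: near_eq_derive.
Qed.

(** Differentiate as many times in each variable as the leading monomial says:
    every other monomial is smaller, so it is not divisible by the leading one and
    is killed. *)
Lemma mderiv_to_constant Q : Q != 0 -> exists s (L : R),
  L != 0 /\ foldr (mderiv (R := R)) Q s = mpolyC n L.
Proof.
move=> Q0; set m := mlead Q.
exists (flatten [seq nseq (m i) i | i <- enum 'I_n]).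
exists (mcoeff m Q *+ (\prod_(i < n) (m i)`!)); split.
  rewrite mulrn_eq0 negb_or mleadc_eq0 Q0 andbT -lt0n.
  by rewrite prodn_gt0 // => i; exact: fact_gt0.
rewrite -mderivm_foldr; apply/mpolyP => k; rewrite mcoeff_mderivm mcoeffC.
have [->|k0] := eqVneq k mnm0.
  rewrite addm0 mulr1; congr (_ *+ _).
  by apply: eq_bigr => i _; exact: ffactnn.
rewrite mulr0 mcoeff_gt_mlead ?mul0rn // -/m -{1}[m]addm0.
by rewrite ltmc_add2r lt_neqAle le0m eq_sym k0.
Qed.

(** Otherwise all the iterated derivatives would vanish near [x], including the one
    that is a nonzero constant. *)
Lemma poly_not_vanishing P x : P != 0 ->
  ~ \forall y \near x, poly_fun P y = 0.
Proof.
move=> P0 Px; have [s [L [L0 PL]]] := mderiv_to_constant P0.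
have : \forall y \near x, poly_fun P y = poly_fun 0 y.
  by apply: filterS Px => y ->; rewrite /poly_fun meval0.
move=> /(foldr_partial_near s) /nbhs_singleton.
rewrite !foldr_partial_poly PL (_ : foldr _ 0 s = 0).
  by rewrite /poly_fun mevalC meval0 => /eqP; rewrite (negPf L0).
by elim: s {PL} => //= i s ->; exact: mderiv0.
Qed.

Lemma near_norm_lt x (r : R) : `|x| < r -> \forall y \near x, `|y| < r.
Proof.
move=> xr; apply/(@nbhs_normP R V); exists (r - `|x|) => /=.
  by rewrite subr_gt0.
move=> y /=; rewrite ltrBrDl => xy; apply: le_lt_trans xy.
have {1}-> : y = x - (x - y) by rewrite opprB addrC subrK.
exact: ler_normB.
Qed.

(** By density of the nonzero locus of a polynomial. *)
Lemma continuous_vanishing P h (r : R) x : P != 0 -> `|x| < r ->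
  {for x, continuous h} -> (forall y, `|y| < r -> poly_fun P y != 0 -> h y = 0) ->
  h x = 0.
Proof.
move=> P0 xr hc hP; apply: contrapT => /eqP hx.
apply: (@poly_not_vanishing P x P0).
have yr := near_norm_lt xr.
have hy : \forall y \near x, h y != 0.
  apply: (@cvgr_neq0 _ _ _ _ _ h (h x) hc); exact: hx.
near=> y; apply: contrapT => /eqP Py.
have /eqP : h y != 0 by near: y.
by apply; apply: hP => //; near: y.
Unshelve. all: by end_near.
Qed.

Lemma is_derive_line h z v (l s : R) : is_derive (s *: v + z) v h l ->
  is_derive s 1 (fun t : R => h (t *: v + z)) l.
Proof.
case=> hd hl.
have E : (fun t : R => t^-1 *: (h ((t *: (1 : R) + s) *: v + z) - h (s *: v + z)))
   = (fun t : R => t^-1 *: (h (t *: v + (s *: v + z)) - h (s *: v + z))).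
  by apply/funext => t; rewrite addrA -scalerDl [t *: _]mulr1.
apply: DeriveDef; first by rewrite /derivable E.
by rewrite /derive E.
Qed.

Lemma constant_on_line h z i (c : R) : 0 <= c ->
  (forall s : R, 0 <= s <= c -> is_derive (s *: delta_mx 0 i + z) (delta_mx 0 i) h 0) ->
  h (c *: delta_mx 0 i + z) = h z.
Proof.
move=> c0 hd; pose phi (s : R) := h (s *: delta_mx 0 i + z).
have phid (s : R) : s \in `[0, c] -> is_derive s 1 phi 0.
  by rewrite in_itv /= => sc; apply: is_derive_line; exact: hd.
have phic : {within `[0, c], continuous phi}.
  by apply: derivable_within_continuous => s /phid[].
have phio (s : R) : s \in `]0, c[ -> is_derive s 1 phi 0.
  by move=> sc; apply: phid; exact: subset_itv_oo_cc.
have [d _] := MVT_segment (df := fun=> 0) c0 phio phic.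
by rewrite mul0r /phi scale0r add0r => /eqP; rewrite subr_eq0 => /eqP.
Qed.

(** Balls are cubes for the norm of ['rV[R]_n], so that two points of a ball can be
    joined inside it by changing the coordinates one at a time. *)
Lemma zero_partials_constant x0 (r : R) h :
  (forall x, `|x - x0| < r -> forall i, is_derive x (delta_mx 0 i) h 0) ->
  forall x y, `|x - x0| < r -> `|y - x0| < r -> h y = h x.
Proof.
move=> hd.
have step x y i : (forall j, j != i -> x 0 j = y 0 j) -> x 0 i <= y 0 i ->
    `|x - x0| < r -> `|y - x0| < r -> h y = h x.
  move=> xy xyi xr yr.
  have yE : y = (y 0 i - x 0 i) *: delta_mx 0 i + x.
    apply/rowP => j; rewrite !mxE eqxx /=; have [->|ji] := eqVneq j i.
      by rewrite mulr1 subrK.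
    by rewrite mulr0 add0r xy.
  rewrite [in LHS]yE; apply: constant_on_line; first by rewrite subr_ge0.
  move=> s /andP[s0 sc]; apply: hd.
  apply: normr_rV_lt => [|j]; first by exact: le_lt_trans xr.
  rewrite !mxE eqxx /=.
  have xj := le_lt_trans (normr_coord (x - x0) j) xr.
  have yj := le_lt_trans (normr_coord (y - x0) j) yr.
  rewrite !mxE in xj yj; have [ji|ji] := eqVneq j i; last first.
    by rewrite mulr0 add0r.
  move: xj yj; rewrite ji mulr1 !ltr_norml => /andP[a1 a2] /andP[b1 b2].
  by apply/andP; split; lra.
move=> x y xr yr.
(* The first [k] coordinates are those of [y], the other ones those of [x]. *)
pose z k : V := \row_j (if (j < k)%N then y 0 j else x 0 j).
have zr k : `|z k - x0| < r.
  apply: normr_rV_lt => [|j]; first by exact: le_lt_trans xr.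
  rewrite !mxE; case: ifP => _.
    by have := le_lt_trans (normr_coord (y - x0) j) yr; rewrite !mxE.
  by have := le_lt_trans (normr_coord (x - x0) j) xr; rewrite !mxE.
have -> : y = z n by apply/rowP => j; rewrite mxE ltn_ord.
suff H k : (k <= n)%N -> h (z k) = h x by exact: H.
elim: k => [_|k IH kn]; first by congr h; apply/rowP => j; rewrite mxE.
rewrite -IH ?(ltnW kn) //; pose i := Ordinal kn.
have zE j : j != i -> z k.+1 0 j = z k 0 j.
  move=> ji; rewrite !mxE ltnS leq_eqVlt; have -> // : (j == k :> nat) = false.
  by apply/negbTE; apply: contra ji => /eqP jk; apply/eqP/val_inj.
have [le|/ltW le] := leP (z k 0 i) (z k.+1 0 i).
  by apply: (step _ _ i) => // j ji; rewrite zE.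
by apply/esym/(step _ _ i) => // j ji; rewrite zE.
Qed.

(** Let [p <= 0]. Where [P] does not vanish, the quotient of a solution by the
    power of [P] is locally constant. A derivative that maps the power of [P] to a
    nonzero constant turns this quotient, up to a constant factor, into a
    derivative of the solution. The latter is continuous and has zero partial
    derivatives on a dense set: hence the local constants are the same on all the
    components of the nonzero locus. *)
Theorem smooth_solutions P (g : fun_germ R n) (p : int) : P != 0 ->
  germs (smooth_germs R n) g ->
  (forall i, germ_of_mpoly P * germ_partial i g +
     (g * germ_partial i (germ_of_mpoly P)) *~ p = 0) ->
  (0 < p -> mcoeff mnm0 P = 0 -> g = 0) /\
  (p <= 0 -> exists c : R, g = c *: germ_of_mpoly (P ^+ `|p|%N)).
Proof.
move=> P0 [h hs <-] eqn; have complR := @complete_field_real R.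
have eqnear i : \forall x \near (0 : V), poly_fun P x * fun_partial i h x +
      p%:~R * (h x * poly_fun (mderiv i P) x) = 0.
  have := eqn i; rewrite germ_partial_mpoly // germ_partialE -scaler_int.
  by rewrite -!germ_ofM -germ_ofZ -germ_ofD -germ_of0 => /germ_ofP.
have eqall : \forall x \near (0 : V), forall i,
    poly_fun P x * fun_partial i h x +
      p%:~R * (h x * poly_fun (mderiv i P) x) = 0.
  exact: (@filter_forall V _ (fun i x => poly_fun P x * fun_partial i h x +
      p%:~R * (h x * poly_fun (mderiv i P) x) = 0) (nbhs (0 : V)) _ eqnear).
have [r r0 hr] := (proj1 (nbhs0P _)) (filterI eqall hs).
have hE x : `|x| < r -> forall i, poly_fun P x * fun_partial i h x =
    - p%:~R * (h x * poly_fun (mderiv i P) x).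
  by move=> /hr[hx _] i; apply/eqP; rewrite -subr_eq0 mulNr opprK hx.
have hC x s : `|x| < r -> {for x, continuous (foldr (@fun_partial R n) h s)}.
  by move=> /hr[_ /(_ s)[]].
have hD x s i : `|x| < r -> is_derive x (delta_mx 0 i)
    (foldr (@fun_partial R n) h s) (foldr (@fun_partial R n) h (i :: s) x).
  by move=> /hr[_ /(_ s)[_ hx]]; apply: DeriveDef.
have hx0 : `|0 : V| < r by rewrite normr0.
pose k := `|p|%N; pose q := P ^+ k.
have qx x : poly_fun q x = poly_fun P x ^+ k by rewrite /poly_fun rmorphXn.
have q' i x : poly_fun (mderiv i q) x =
    k%:R * (poly_fun P x ^+ k.-1 * poly_fun (mderiv i P) x).
  by rewrite mderivXn /poly_fun mevalMn mevalM rmorphXn mulr_natl.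
have dq i x := is_derive_poly complR i q x.
split=> [p0 P00|p0].
  have k0 : (0 < k)%N by rewrite absz_gt0 gt_eqF.
  have kp : p%:~R = k%:R :> R by rewrite pmulrn /k abszE gtr0_norm.
  have der0 x : `|x| < r -> forall i, is_derive x (delta_mx 0 i)
      (h * poly_fun q) 0.
    move=> xr i; apply: is_derive_eq (is_deriveM (hD x [::] i xr) (dq i x)) _.
    rewrite /GRing.scale /= q' qx -(prednK k0) exprSr /= prednK //.
    rewrite -[_ * poly_fun P x * _]mulrA hE // kp; ring.
  have hq0 : h 0 * poly_fun q 0 = 0.
    rewrite qx (_ : poly_fun P 0 = 0) ?expr0n ?gtn_eqF ?mulr0 //.
    rewrite -[RHS]P00; apply: (sums_to_at0 (a := fps_of_mpoly P)).
    exact: sums_to_mpoly.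
  have hq x : `|x| < r -> h x * poly_fun q x = 0.
    move=> xr; rewrite -hq0.
    apply: (@zero_partials_constant 0 r (h * poly_fun q)); rewrite ?subr0 //.
    by move=> y; rewrite subr0; exact: der0.
  rewrite -germ_of0; apply/germ_ofP/nbhs0P; exists r => // x xr.
  apply: (continuous_vanishing P0 xr (hC x [::] xr)) => y yr Py.
  have /eqP := hq y yr; rewrite mulf_eq0 qx expf_eq0 (negPf Py) andbF orbF.
  by move/eqP.
have kp : - p%:~R = k%:R :> R.
  by rewrite -rmorphN pmulrn /k abszE ler0_norm.
have q0 : q != 0 by rewrite expf_neq0.
have hq x : `|x| < r -> poly_fun P x != 0 -> forall i,
    fun_partial i h x * poly_fun q x = h x * poly_fun (mderiv i q) x.
  move=> xr Px i; apply: (mulfI Px); rewrite mulrA hE // kp q' qx.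
  case: (k) => [|k'] /=; first by rewrite !(mul0r, mulr0).
  by rewrite exprS; ring.
have locally_proportional x : `|x| < r -> poly_fun P x != 0 ->
    \forall y \near x, h y = poly_fun (h x / poly_fun q x *: q) y.
  move=> xr Px.
  have yr := near_norm_lt xr.
  have Py : \forall y \near x, poly_fun P y != 0.
    apply: (@cvgr_neq0 _ _ _ _ _ _ _ (@continuous_poly P x)); exact: Px.
  have /(@nbhs_normP R V)[e e0 he] : \forall y \near x,
    `|y| < r /\ poly_fun P y != 0 by exact: filterI.
  have he' y : `|y - x| < e -> `|y| < r /\ poly_fun P y != 0.
    by rewrite distrC => /he.
  pose u := h * (fun y => (poly_fun q y)^-1).
  have u0 y : `|y - x| < e -> forall i, is_derive y (delta_mx 0 i) u 0.
    move=> /he'[yr' Py'] i; have qy : poly_fun q y != 0 by rewrite qx expf_neq0.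
    have [dq1 dq2] := dq i y.
    have dV : is_derive y (delta_mx 0 i) (fun y => (poly_fun q y)^-1)
        (- poly_fun q y ^- 2 *: poly_fun (mderiv i q) y).
      by apply: DeriveDef; [exact: derivableV|rewrite deriveV // dq2].
    apply: is_derive_eq (is_deriveM (hD y [::] i yr') dV) _.
    rewrite /GRing.scale /= [_^-1 * _]mulrC.
    have -> : fun_partial i h y = h y * poly_fun (mderiv i q) y / poly_fun q y.
      by rewrite -hq // mulfK.
    by field.
  apply/(@nbhs_normP R V); exists e => // y; rewrite /= distrC => yx.
  have [yr' Py'] := he' y yx.
  have xx : `|x - x| < e by rewrite subrr normr0.
  have := zero_partials_constant u0 xx yx; rewrite /u /= => uxy.
  have qy : poly_fun q y != 0 by rewrite qx expf_neq0.
  rewrite [RHS]mevalZ -/(poly_fun q y).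
  by apply: (mulIf (invr_neq0 qy)); rewrite mulfK //; exact: uxy.
have [s [L [L0 qL]]] := mderiv_to_constant q0.
have foldZ (c : R) s' : foldr (mderiv (R := R)) (c *: q) s' =
    c *: foldr (mderiv (R := R)) q s'.
  by elim: s' => //= i s' ->; rewrite mderivZ.
have Hs x : `|x| < r -> poly_fun P x != 0 -> forall s',
    foldr (@fun_partial R n) h s' x =
    h x / poly_fun q x * poly_fun (foldr (mderiv (R := R)) q s') x.
  move=> xr Px s'.
  have /nbhs_singleton := foldr_partial_near s' (locally_proportional x xr Px).
  by rewrite foldr_partial_poly foldZ => ->; rewrite [LHS]mevalZ.
have G0 x : `|x| < r -> forall i, foldr (@fun_partial R n) h (i :: s) x = 0.
  move=> xr i; apply: (continuous_vanishing P0 xr (hC x _ xr)) => y yr Py.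
  by rewrite Hs //= qL mderivC /poly_fun meval0 mulr0.
(* The constant value [c * L] of the derivative of [h] gives back all the local
   constants. *)
pose c := foldr (@fun_partial R n) h s 0 / L.
have Gc x : `|x| < r -> foldr (@fun_partial R n) h s x = c * L.
  move=> xr; rewrite /c divfK //.
  apply: (@zero_partials_constant 0 r); rewrite ?subr0 // => y; rewrite subr0.
  by move=> yr i; rewrite -(G0 y yr i); exact: hD.
exists c; rewrite -germ_ofZ; apply/germ_ofP/nbhs0P; exists r => // x xr.
suff : h x - poly_fun (c *: q) x = 0.
  by move/eqP; rewrite subr_eq0 => /eqP ->; exact: mevalZ.
apply: (@continuous_vanishing P (fun y => h y - poly_fun (c *: q) y) r x P0 xr).
  exact: (cvgB (hC x [::] xr) (@continuous_poly (c *: q) x)).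
move=> y yr Py; have qy : poly_fun q y != 0 by rewrite qx expf_neq0.
have := Gc y yr; rewrite Hs // qL /poly_fun mevalC => /(mulIf L0) hy.
by rewrite mevalZ -hy divfK ?subrr.
Qed.

End SmoothGerms.

(** * Conclusion in each category *)

Section PolynomialGerms.
Variables (R : realType) (C : category) (n : nat).
Local Notation K := (scalars R C).
Local Notation F := (germs_in R C n).
Local Notation gp := (germ_of_polynomial F).
Implicit Types (P Q : mpoly n K).

Lemma poly_germD P Q : gp (P + Q) = gp P + gp Q.
Proof.
by case: (C) P Q => P Q; first [exact: germ_of_mpolyD|exact: fps_of_mpolyD].
Qed.

Lemma poly_germM P Q : gp (P * Q) = gp P * gp Q.
Proof.
by case: (C) P Q => P Q; first [exact: germ_of_mpolyM|exact: fps_of_mpolyM].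
Qed.

Lemma poly_germZ (c : K) P : gp (c *: P) = c *: gp P.
Proof.
by case: (C) c P => c P; first [exact: germ_of_mpolyZ|exact: fps_of_mpolyZ].
Qed.

Lemma poly_germ1 : gp 1 = 1.
Proof. by case: (C); first [exact: germ_of_mpoly1|exact: fps_of_mpoly1]. Qed.

Lemma poly_germX P k : gp (P ^+ k) = gp P ^+ k.
Proof.
by elim: k => [|k IH]; rewrite ?expr0 ?poly_germ1 // !exprS poly_germM IH.
Qed.

Lemma poly_germ0 : gp 0 = 0.
Proof. by rewrite -[in LHS](scale0r 0) poly_germZ scale0r. Qed.

Lemma partial_poly_germ (i : 'I_n) P : partial F i (gp P) = gp (mderiv i P).
Proof.
have := @complete_scalars R C.
by case: (C) P => P cK;
  first [exact: fps_partial_mpoly|exact: germ_partial_mpoly].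
Qed.

Lemma poly_germ_in P : germs F (gp P).
Proof.
have := @complete_scalars R C.
by case: (C) P => P cK //;
  first [exact: analytic_germ_mpoly|exact: smooth_germ_mpoly].
Qed.

Lemma poly_germ_eq0 P : gp P = 0 -> P = 0.
Proof.
have fps0 (L : numFieldType) (Q : mpoly n L) :
    fps_of_mpoly Q = 0 :> fps L n -> Q = 0.
  move=> Q0; apply/mpolyP => m.
  by rewrite mcoeff0 -[LHS]/((fps_of_mpoly Q : fps L n) m) Q0.
have := @complete_scalars R C.
by case: (C) P => P cK; first [exact: germ_of_mpoly_eq0|exact: fps0].
Qed.

Lemma germ_solutions P (g : ambient F) (p : int) : P != 0 -> germs F g ->
  (forall i, gp P * partial F i g + (g * partial F i (gp P)) *~ p = 0) ->
  (0 < p -> mcoeff mnm0 P = 0 -> g = 0) /\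
  (p <= 0 -> exists c : K, g = c *: gp (P ^+ `|p|%N)).
Proof.
have := @complete_scalars R C.
case: (C) P g => P g cK P0 Fg eqn; first
  [ exact: (analytic_solutions cK P0 Fg eqn)
  | exact: (smooth_solutions P0 Fg eqn)
  | exact: (fps_solutions P0 eqn) ].
Qed.

(** If [P = 0], the Jacobian ideal is zero, so that all germs are combinations of
    the [d] germs [e]. But the [d + 1] first powers of a coordinate are linearly
    independent. *)
Lemma finite_codimension_neq0 P :
  (0 < n)%N -> finite_codimension (gp P) -> P != 0.
Proof.
move=> n0 [d [e [_ span]]]; apply/eqP => P0; pose i0 := Ordinal n0.
pose X (j : nat) : mpoly n K := mpolyX K (mnm_muln (mnm1 i0) j).
have combination (j : 'I_d.+1) : exists c : 'I_d -> K,
    gp (X j) = \sum_(l < d) c l *: e l.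
  have [c [h _ hc]] := span _ (poly_germ_in (X j)); exists c.
  apply/eqP; rewrite -subr_eq0 hc P0 poly_germ0 big1 // => i _.
  by rewrite partial0 mulr0.
have [c cE] := choice combination.
pose A : 'M[K]_(d.+1, d) := \matrix_(j, l) c j l.
have : kermx A != 0.
  rewrite kermx_eq0 /row_free; apply/eqP => rA.
  by have := rank_leq_col A; rewrite rA ltnn.
case/rowV0Pn => v /sub_kermxP vA /eqP; apply; apply/rowP => j; rewrite mxE.
have sumX0 : \sum_(k < d.+1) v 0 k *: X k = 0.
  apply: poly_germ_eq0.
  have gp_sum : gp (\sum_(k < d.+1) v 0 k *: X k) =
      \sum_(k < d.+1) v 0 k *: gp (X k).
    rewrite (big_morph gp poly_germD poly_germ0).
    by apply: eq_bigr => k _; rewrite poly_germZ.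
  rewrite gp_sum (eq_bigr (fun k => \sum_(l < d) (v 0 k * c k l) *: e l)).
    rewrite exchange_big big1 // => l _; rewrite -scaler_suml.
    have := congr1 (fun B : 'rV[K]_d => B 0 l) vA; rewrite !mxE => vA0.
    rewrite (_ : \sum_(k < _) _ = 0) ?scale0r // -[RHS]vA0.
    by apply: eq_bigr => k _; rewrite mxE.
  by move=> k _; rewrite cE scaler_sumr; apply: eq_bigr => l _; rewrite scalerA.
have := congr1 (mcoeff (mnm_muln (mnm1 i0) j)) sumX0.
rewrite mcoeff0 raddf_sum (bigD1 j) //= mcoeffZ mcoeffX eqxx mulr1 big1 ?addr0 //.
move=> k kj; rewrite mcoeffZ mcoeffX; case: eqP => [e1|]; last by rewrite mulr0.
case/eqP: kj; apply/val_inj; have := congr1 (fun m : multinom n => m i0) e1.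
by rewrite !mulmnE mnm1E eqxx !mul1n.
Qed.

End PolynomialGerms.

Theorem theorem3p6 (R : realType) (C : category) (n : nat) (hn : (3 <= n)%N)
    (P : mpoly n (scalars R C)) (N : nat) (p : int) :
  let f := germ_of_polynomial (germs_in R C n) P in
  quasihomogeneous N f ->
  meval (fun=> 0) P = 0 ->
  finite_codimension f ->
  (0 < p -> H0 f p = [set 0]) /\
  (p <= 0 -> H0 f p = [set c *: f ^+ `|p|%N | c in [set: scalars R C]]).
Proof.
move=> f _ P00 /finite_codimension_neq0 P0.
have {}P0 : P != 0 by apply: P0; exact: ltn_trans hn.
have {}P00 : mcoeff mnm0 P = 0.
  rewrite -P00; apply/esym/(sums_to_at0 (a := fps_of_mpoly P)).
  rewrite (_ : meval _ P = meval ((0 : 'rV_n) 0) P); first exact: sums_to_mpoly.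
  by apply: meval_eq => i; rewrite mxE.
split=> [p0|p0]; apply/seteqP; split=> g.
- by move=> /H0_germs_in[Fg /(germ_solutions P0 Fg)[+ _]]; apply.
- move=> ->; apply/H0_germs_in; split=> [|i]; first exact: germs0.
  by rewrite partial0 mulr0 mul0r mul0rz addr0.
- move=> /H0_germs_in[Fg /(germ_solutions P0 Fg)[_ /(_ p0)[c ->]]].
  by exists c => //; rewrite poly_germX.
- case=> c _ <-; apply/H0_germs_in; rewrite -poly_germX -poly_germZ.
  split=> [|i]; first exact: poly_germ_in.
  rewrite !partial_poly_germ -scaler_int -!poly_germM -poly_germZ -poly_germD.
  rewrite mderivZ -scalerAr -scalerAl scalerA [_%:~R * c]mulrC.
  rewrite -scalerA -scalerDr.
  by rewrite scaler_int exp_solution // scaler0 poly_germ0.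
Qed.
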